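(* Let $0<\rho<1$. Then there is a set $E$ consisting of at most two primes such that for every prime $p\notin E$ the following holds for $\mu_{\rho}$-almost every $\omega\in\Omega=\{0,1\}^{\mathbb{N}}$: the set $\mathcal{L}(\alpha_{\omega})\subset[0,\log p]$ of limit points of the periodic point growth rates $\frac{1}{n}\log|F_n(\alpha_{\omega})|$ of the automorphism $\alpha_{\omega}:X_{\omega}\to X_{\omega}$ is an infinite set containing $0$, $\log p$, and a sequence of pairwise distinct elements converging to $\log p$.
   Context: Let $p$ be a prime and $K=\mathbb{F}_p(t)$. The places of $K$ are the infinite place together with the finite places, which are in one-to-one correspondence with the monic irreducible polynomials $v\in\mathbb{F}_p[t]$; for a finite place $v$, $|f|_{v}=p^{-\mathrm{ord}_v(f)\deg(v)}$ for $f\in K\setminus\{0\}$ (and $|0|_v=0$), where $\mathrm{ord}_v(f)$ is the exponent of $v$ in the factorization of $f$. For each $p$, fix an (arbitrary) enumeration $v_{-1},v_0,v_1,v_2,\dots$ of the set of all places of $K$, each listed exactly once, with $v_{-1}$ the infinite place and $v_0$ the place corresponding to the irreducible polynomial $t$; thus $v_1,v_2,\dots$ enumerates the places corresponding to the monic irreducible polynomials other than $t$. Let $\Omega=\{0,1\}^{\mathbb{N}}$, with points $\omega=(\omega(k))_{k\ge1}$, and let $\mu_{\rho}=(\rho,1-\rho)^{\mathbb{N}}$ be the infinite product measure, under which the coordinates $\omega(k)$ are independent with $\omega(k)=0$ with probability $\rho$ and $\omega(k)=1$ with probability $1-\rho$. Each $\omega\in\Omega$ defines a ring $$R_{\omega}=\{f\in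 K: |f|_{v_k}\le 1\text{ for all }k\ge1\text{ such that }\omega(k)=0\}.$$ (No condition is imposed at the infinite place or at the place $t$, so $t$ is a unit in $R_\omega$.) $X_{\omega}$ is the compact abelian group that is the Pontryagin dual of the discrete additive group of $R_{\omega}$, and $\alpha_{\omega}:X_{\omega}\to X_{\omega}$ is the continuous automorphism dual to the automorphism $f\mapsto tf$ of the additive group of $R_{\omega}$. For $n\ge1$, $F_n(\alpha_{\omega})=\{x\in X_{\omega}:\alpha_{\omega}^n(x)=x\}$ is the (finite) set of points of period $n$ under $\alpha_\omega$, and $|F_n(\alpha_\omega)|$ is its cardinality. $\mathcal{L}(\alpha_{\omega})$ denotes the set of limit points of the sequence $\left(\frac1n\log|F_n(\alpha_{\omega})|\right)_{n\ge1}$, that is, the set of all limits of its convergent subsequences (along $n_j\to\infty$). *)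

(* Defs.v *)
From HB Require Import structures.
From mathcomp Require Import all_boot all_order all_algebra.
From mathcomp Require Import all_classical all_reals all_analysis.
From mathcomp Require Import finmap measurable_realfun complex.

Set Implicit Arguments.
Unset Strict Implicit.
Unset Printing Implicit Defensive.

Import Order.TTheory GRing.Theory Num.Theory.
Import numFieldNormedType.Exports.

Local Open Scope classical_set_scope.
Local Open Scope ring_scope.

Notation ratfun p := {fraction {poly 'F_p}}.

Inductive place (p : nat) : Type :=
| InfinitePlace
| FinitePlace (v : {poly 'F_p}) of v \is monic & irreducible_poly v.
Arguments InfinitePlace {p}.

(* The exponent of v in a, for a != 0 and v nonconstant. *)
Definition poly_mult (p : nat) (v a : {poly 'F_p}) : nat :=
  \max_(n < size a | v ^+ n %| a) n.

(* At the infinite place ord is minus the degree, so that |f| = p ^ deg f. *)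
Definition place_ordp (p : nat) (w : place p) (a : {poly 'F_p}) : int :=
  match w with
  | InfinitePlace => - (size a).-1%:Z
  | FinitePlace v _ _ => (poly_mult v a)%:Z
  end.

Definition place_deg (p : nat) (w : place p) : nat :=
  match w with
  | InfinitePlace => 1
  | FinitePlace v _ _ => (size v).-1
  end.

(* Does not depend on the chosen representative: see place_ordE. *)
Definition place_ord (p : nat) (w : place p) (f : ratfun p) : int :=
  place_ordp w (frac (repr f)).1 - place_ordp w (frac (repr f)).2.

Definition place_abs (p : nat) (w : place p) (f : ratfun p) : rat :=
  if f == 0 then 0 else p%:R ^ (- (place_ord w f * (place_deg w)%:Z)).

Section valuation.
Variables (p : nat).
Implicit Types (v a b c d : {poly 'F_p}) (w : place p) (f g : ratfun p).

Lemma poly_multP v a n : (1 < size v)%N -> a != 0 ->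
  (v ^+ n %| a) = (n <= poly_mult v a)%N.
Proof.
move=> v1 a0; have v0 : v != 0 by rewrite -size_poly_gt0 ltnW.
have bnd m : v ^+ m %| a -> (m < size a)%N.
  move=> /(dvdp_leq a0); apply: leq_trans.
  rewrite -(prednK (n := size (v ^+ m))) ?size_poly_gt0 ?expf_neq0 //.
  by rewrite size_exp ltnS leq_pmull // -subn1 subn_gt0.
apply/idP/idP => [h|h].
  by rewrite /poly_mult (bigop.bigmax_sup (Ordinal (bnd _ h))).
have [i hi ei] : exists2 i : 'I_(size a), v ^+ i %| a & poly_mult v a = i.
  have lt0 : (0 < size a)%N by rewrite size_poly_gt0.
  case: (@eq_bigmax_cond 'I_(size a) [pred i : 'I_(size a) | v ^+ i %| a] (fun i => i : nat)).
    by apply/card_gt0P; exists (Ordinal lt0); rewrite inE /= expr0 dvd1p.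
  by move=> i hi e; exists i.
by apply: dvdp_trans hi; apply: dvdp_exp2l; rewrite -ei.
Qed.

Lemma poly_multM v a b : irreducible_poly v -> a != 0 -> b != 0 ->
  poly_mult v (a * b) = (poly_mult v a + poly_mult v b)%N.
Proof.
move=> irr a0 b0; have v1 : (1 < size v)%N by case: irr.
have v0 := irredp_neq0 irr.
have split_off c : c != 0 -> exists2 d, ~~ (v %| d) & c = d * v ^+ poly_mult v c.
  move=> c0; have /dvdpP[d dE] : v ^+ poly_mult v c %| c by rewrite poly_multP.
  exists d => //; apply/negP => vd.
  have : v ^+ (poly_mult v c).+1 %| c.
    by rewrite [X in _ %| X]dE exprS dvdp_mul.
  by rewrite poly_multP // ltnn.
have [a' va' aE] := split_off _ a0; have [b' vb' bE] := split_off _ b0.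
set m := poly_mult v a in aE *; set n := poly_mult v b in bE *.
have ab0 : a * b != 0 by rewrite mulf_neq0.
have abE : a * b = (a' * b') * v ^+ (m + n) by rewrite aE bE exprD mulrACA.
have vab' : ~~ (v %| a' * b').
  by rewrite Gauss_dvdpr ?irreducible_poly_coprime.
apply/eqP; rewrite eqn_leq -[(m + n <= _)%N]poly_multP // leqNgt.
rewrite -poly_multP // abE dvdp_exp_sub // subSnn expr1 vab'.
by rewrite dvdp_mull.
Qed.

Lemma place_ordpM w a b : a != 0 -> b != 0 ->
  place_ordp w (a * b) = place_ordp w a + place_ordp w b.
Proof.
move=> a0 b0; case: w => [|v vm irr] /=; last by rewrite poly_multM // PoszD.
rewrite size_mul // -opprD -PoszD; congr (- Posz _).
have := a0; have := b0; rewrite -!size_poly_gt0.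
by case: (size a) (size b) => [|n] [|m] //= _ _; rewrite addnS.
Qed.

Lemma place_ordpD w a b n : a != 0 -> b != 0 -> a + b != 0 ->
  n <= place_ordp w a -> n <= place_ordp w b -> n <= place_ordp w (a + b).
Proof.
move=> a0 b0 ab0; case: w => [|v vm irr] /=.
  move=> ha hb; suff: (size (a + b)).-1%:Z <= Num.max (size a).-1%:Z (size b).-1%:Z.
    rewrite le_max => /orP[] h.
      by apply: (le_trans ha); rewrite lerN2.
    by apply: (le_trans hb); rewrite lerN2.
  rewrite le_max !lez_nat; have := size_polyD a b; rewrite leq_max.
  by case/orP => h; apply/orP; [left|right]; rewrite -!subn1 leq_sub2r.
have v1 : (1 < size v)%N by case: irr.
case: n => [n|n] // ha hb; rewrite !lez_nat in ha hb *.
by rewrite -poly_multP // dvdp_add // poly_multP.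
Qed.

Lemma ratfun_repr f : f * tofrac (frac (repr f)).2 = tofrac (frac (repr f)).1.
Proof.
rewrite -[X in X * _]reprK; have := denom_ratioP (repr f).
move: (repr f) => x x0; unlock tofrac; rewrite -[LHS]FracField.pi_mul.
apply/eqmodP; rewrite /= FracField.equivfE /FracField.mulf.
by rewrite !numden_Ratio ?mulr1 ?oner_eq0 // mulrC.
Qed.

Lemma place_ordE w f a b : b != 0 -> f != 0 -> f * tofrac b = tofrac a ->
  place_ord w f = place_ordp w a - place_ordp w b.
Proof.
move=> b0 f0 fE; have fE' := ratfun_repr f; have d0 := denom_ratioP (repr f).
have a0 : a != 0 by rewrite -tofrac_eq0 -fE mulf_neq0 ?tofrac_eq0.
rewrite /place_ord; move: (frac (repr f)).1 (frac (repr f)).2 fE' d0 => n d fE' d0.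
have n0 : n != 0 by rewrite -tofrac_eq0 -fE' mulf_neq0 ?tofrac_eq0.
have e : n * b = a * d.
  by apply/eqP; rewrite -tofrac_eq !tofracM -fE -fE' mulrAC.
apply/eqP; rewrite subr_eq addrAC eq_sym subr_eq.
by rewrite -!place_ordpM // e.
Qed.

Lemma place_abs_le1 w f : (1 < p)%N -> f != 0 ->
  (place_abs w f <= 1) = (0 <= place_ord w f).
Proof.
move=> p1 f0; rewrite /place_abs (negbTE f0).
have p1' : 1 < p%:R :> rat by rewrite ltr1n.
have dw : 0 < (place_deg w)%:Z.
  by case: w => //= v _ [v1 _]; rewrite ltz_nat -subn1 subn_gt0.
by rewrite -[X in _ <= X](expr0z p%:R) (ler_eXz2l p1') oppr_le0 pmulr_lge0.
Qed.

Lemma place_abs_le1_trivial w f : (p <= 1)%N -> place_abs w f <= 1.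
Proof.
rewrite /place_abs; case: eqP => // _; move: (- _) => z; move: p => [|[|//]] _.
  by rewrite exp0rz; case: (_ == _).
by rewrite exp1rz.
Qed.

Lemma place_ordpN w a : place_ordp w (- a) = place_ordp w a.
Proof.
case: w => [|v vm irr] /=; first by rewrite size_polyN.
rewrite /poly_mult size_polyN; congr Posz.
by apply: eq_bigl => n; rewrite dvdpNr.
Qed.

Definition ordp_le w b a := (a == 0) || (place_ordp w b <= place_ordp w a).

Lemma place_abs_le1P w f : (1 < p)%N ->
  reflect (exists a b, [/\ b != 0, f * tofrac b = tofrac a & ordp_le w b a])
    (place_abs w f <= 1).
Proof.
move=> p1; have [->|f0] := eqVneq f 0.
  rewrite /place_abs eqxx ler01; constructor; exists 0, 1.
  by rewrite oner_eq0 mul0r tofrac0 /ordp_le eqxx.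
apply: (iffP idP) => [|[a [b [b0 fE]]]].
  rewrite place_abs_le1 // => h; exists (frac (repr f)).1, (frac (repr f)).2.
  split; [exact: denom_ratioP|exact: ratfun_repr|].
  by rewrite /ordp_le -subr_ge0 h orbT.
have a0 : a != 0 by rewrite -tofrac_eq0 -fE mulf_neq0 ?tofrac_eq0.
rewrite /ordp_le (negbTE a0) /= => h.
by rewrite place_abs_le1 // (place_ordE w b0 f0 fE) subr_ge0.
Qed.

Lemma ordp_leM w b a d c : b != 0 -> d != 0 ->
  ordp_le w b a -> ordp_le w d c -> ordp_le w (b * d) (a * c).
Proof.
move=> b0 d0; rewrite /ordp_le mulf_eq0.
have [//|a0] := eqVneq a 0; have [//|c0] := eqVneq c 0.
by rewrite /= !place_ordpM //; apply: lerD.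
Qed.

Lemma ordp_leB w b a c : ordp_le w b a -> ordp_le w b c -> ordp_le w b (a - c).
Proof.
rewrite /ordp_le; have [->|a0] := eqVneq a 0.
  by rewrite sub0r oppr_eq0 place_ordpN.
have [->|c0] := eqVneq c 0; first by rewrite subr0 (negbTE a0).
have [//|ac0] := eqVneq (a - c) 0 => /= ha hc.
by apply: place_ordpD; rewrite ?oppr_eq0 ?place_ordpN.
Qed.

Lemma place_abs_subring w :
  GRing.subring_closed [pred f : ratfun p | place_abs w f <= 1].
Proof.
have [p1|p1] := leqP p 1.
  by split => [|f g _ _|f g _ _]; rewrite inE place_abs_le1_trivial.
split=> [|f g|f g]; rewrite !inE.
- apply/place_abs_le1P => //; exists 1, 1.
  by rewrite oner_eq0 mul1r /ordp_le lexx orbT.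
- move=> /(place_abs_le1P _ _ p1)[a [b [b0 fE hf]]].
  move=> /(place_abs_le1P _ _ p1)[c [d [d0 gE hg]]].
  apply/place_abs_le1P => //; exists (a * d - c * b), (b * d).
  split; first by rewrite mulf_neq0.
    by rewrite mulrBl tofracB !tofracM -fE -gE !mulrA (mulrAC g).
  apply: ordp_leB; first by apply: ordp_leM; rewrite // /ordp_le lexx orbT.
  by rewrite [b * d]mulrC; apply: ordp_leM; rewrite // /ordp_le lexx orbT.
- move=> /(place_abs_le1P _ _ p1)[a [b [b0 fE hf]]].
  move=> /(place_abs_le1P _ _ p1)[c [d [d0 gE hg]]].
  apply/place_abs_le1P => //; exists (a * c), (b * d).
  split; [by rewrite mulf_neq0|by rewrite !tofracM mulrACA fE gE|].
  exact: ordp_leM.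
Qed.

Lemma place_absX_le1 v vm vi : place_abs (@FinitePlace p v vm vi) (tofrac 'X) <= 1.
Proof.
have [p1|p1] := leqP p 1; first by rewrite place_abs_le1_trivial.
apply/place_abs_le1P => //; exists 'X, 1; rewrite oner_eq0 tofrac1 mulr1.
split=> //; rewrite /ordp_le; apply/orP; right.
have := place_ordpM (FinitePlace vm vi) (oner_neq0 _) (oner_neq0 _).
rewrite mul1r => /eqP; rewrite -subr_eq subrr eq_sym => /eqP ->.
by rewrite lez_nat.
Qed.
End valuation.

(* An enumeration v_{-1}, v_0, v_1, ... without repetition of all the places;
   the values of place_at below -1 play no role. *)
Record place_enum (p : nat) := PlaceEnum {
  place_at :> int -> place p;
  place_at_bij : set_bij [set k : int | -1 <= k] [set: place p] place_at;
  place_at_infty : place_at (-1) = InfinitePlace;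
  place_at_t : exists vm vi, place_at 0 = @FinitePlace p 'X vm vi
}.

Lemma place_enum_finite (p : nat) (v : place_enum p) (k : nat) :
  exists w wm wi, v k.+1%:Z = @FinitePlace p w wm wi.
Proof.
case E : (v k.+1%:Z) => [|w wm wi]; last by exists w, wm, wi.
have [_ inj _] := place_at_bij v.
have := inj k.+1%:Z (-1); rewrite place_at_infty E.
have h1 : k.+1%:Z \in [set j : int | -1 <= j] by apply/mem_set.
have h2 : -1 \in [set j : int | -1 <= j] by apply/mem_set.
by move=> /(_ h1 h2 erefl).
Qed.

Section ring.
Context (p : nat) (v : place_enum p) (omega : nat -> bool).

Definition R_pred : {pred ratfun p} := fun f =>
  `[< forall k : nat, omega k = false -> place_abs (v k.+1%:Z) f <= 1 >].

Lemma R_pred_subring : GRing.subring_closed R_pred.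
Proof.
have sub k := place_abs_subring (v k.+1%:Z).
split=> [|f g /asboolP hf /asboolP hg|f g /asboolP hf /asboolP hg];
  apply/asboolP => k hk; have [h1 hB hM] := sub k.
- exact: h1.
- by apply: hB; [exact: hf|exact: hg].
- by apply: hM; [exact: hf|exact: hg].
Qed.

HB.instance Definition _ :=
  GRing.isSubringClosed.Build (ratfun p) R_pred R_pred_subring.

Record R_ring := RRing { R_val :> ratfun p; R_valP : R_val \in R_pred }.

HB.instance Definition _ := [isSub for R_val].
HB.instance Definition _ := [Choice of R_ring by <:].
HB.instance Definition _ := [SubChoice_isSubComNzRing of R_ring by <:].

Lemma t_in_R : tofrac 'X \in R_pred.
Proof.
apply/asboolP => k _; have [w [wm [wi ->]]] := place_enum_finite v k.
exact: place_absX_le1.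
Qed.

Definition R_t : R_ring := RRing t_in_R.

End ring.

(* The Pontryagin dual of a discrete abelian group: every homomorphism to the
   unit circle is continuous. *)
Record dual (R : realType) (G : zmodType) := Character {
  char_val :> G -> R[i];
  char_norm : forall x, `|char_val x| = 1;
  char_add : forall x y, char_val (x + y) = char_val x * char_val y
}.

(* Needed only to speak of finite sets of characters with fset_set. *)
HB.instance Definition _ (R : realType) (G : zmodType) :=
  gen_eqMixin (dual R G).
HB.instance Definition _ (R : realType) (G : zmodType) :=
  gen_choiceMixin (dual R G).

Section dual_map.
Context (R : realType) (G H : zmodType) (phi : {additive G -> H}).
Variable chi : dual R H.

Let norm x : `|chi (phi x)| = 1. Proof. exact: char_norm. Qed.
Let add x y : chi (phi (x + y)) = chi (phi x) * chi (phi y).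
Proof. by rewrite raddfD char_add. Qed.

Definition dual_map : dual R G := Character norm add.
End dual_map.

Section dynamics.
Context (R : realType) (p : nat) (v : place_enum p) (omega : nat -> bool).

Definition X_dual := dual R (R_ring v omega).

Definition alpha : X_dual -> X_dual :=
  dual_map (R_t v omega \*o idfun).

Definition periodic_points (n : nat) : set X_dual :=
  [set x | iter n alpha x = x].

Definition growth_rate (n : nat) : R :=
  ln (#|` fset_set (periodic_points n)|%fset)%:R / n%:R.
End dynamics.

Definition limit_points (R : realType) (u : nat -> R) : set R :=
  [set l | exists phi : nat -> nat,
    {homo phi : i j / (i < j)%N} /\ u \o phi @ \oo --> l].

(* The growth rates are indexed by the periods n >= 1. *)
Definition growth_limit_points (R : realType) (p : nat) (v : place_enum p)
    (omega : nat -> bool) : set R :=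
  limit_points (fun n => growth_rate R v omega n.+1).
Arguments growth_limit_points R {p} v omega _.

(* A point omega : nat -> bool stands for the sequence omega(1), omega(2), ...:
   omega k is the coordinate of index k + 1, with false = 0 and true = 1. The
   sigma-algebra is the product one. *)
Definition coordinate_sets : set (set (nat -> bool)) :=
  [set A | exists k b, A = [set omega | omega k = b]].

Notation Omega := (g_sigma_algebraType coordinate_sets).

(* The values on the cylinders determine mu; existence is
   bernoulli_product_exists below. *)
Definition is_bernoulli_product (R : realType) (rho : R)
    (mu : probability Omega R) : Prop :=
  forall (n : nat) (b : nat -> bool),
    mu [set omega : Omega | forall k, (k < n)%N -> omega k = b k] =
    (\prod_(k < n) (if b k then 1 - rho else rho))%:E.

Section existence.
Context (R : realType) (rho : R) (rho01 : 0 < rho < 1).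

Let branch (x : R) : R := if x < rho then x / rho else (x - rho) / (1 - rho).
Let code (x : R) : Omega := fun k => rho <= iter k branch x.

Let mbranch : measurable_fun [set: R] branch.
Proof.
apply: measurable_fun_ifT; first exact: measurable_fun_ltr.
  exact: measurable_funM.
by apply: measurable_funM => //; exact: measurable_funB.
Qed.

Let mcode : measurable_fun [set: R] code.
Proof.
apply: (measurability (coordinate_sets : set (set Omega))) => // _ [A [k [b ->]] <-].
rewrite setTI; have mk : measurable_fun [set: R] (fun x => code x k).
  apply: measurable_fun_ler => //.
  by elim: k => [|k IH] /=; [exact: measurable_id|exact: (measurableT_comp mbranch IH)].
by rewrite -[X in measurable X]setTI; apply: (mk _ [set b]).
Qed.

Let cyl n (b : nat -> bool) : set R :=
  [set x | (x \in `[0, 1[) /\ forall k, (k < n)%N -> code x k = b k].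

Let cylE n (b : nat -> bool) : exists a c : R, [/\ 0 <= a, a <= c, c <= 1,
  c - a = \prod_(k < n) (if b k then 1 - rho else rho) & cyl n b = [set` `[a, c[ ]].
Proof.
have /andP[r0 r1] := rho01; have r1' : 0 < 1 - rho by rewrite subr_gt0.
elim: n b => [|n IH] b.
  exists 0, 1; rewrite lexx ler01 big_ord0 subr0; split=> //.
  by apply/seteqP; split => x /=; [case|split].
have [a [c [a0 ac c1 e E]]] := IH (b \o S).
have step x : cyl n.+1 b x <->
    [/\ x \in `[0, 1[, (rho <= x) = b 0%N & cyl n (b \o S) (branch x)].
  rewrite /cyl /=; split=> [[x01 h]|[x01 h0 [_ h]]].
    split=> //; first exact: (h 0%N).
    split=> [|k kn]; last by rewrite -h // /code iterSr.
    move: x01; rewrite !in_itv /= /branch => /andP[x0 x1]; case: ltP => hx.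
      by rewrite divr_ge0 ?(ltW r0) //= ltr_pdivrMr // mul1r.
    by rewrite divr_ge0 ?subr_ge0 ?(ltW r1) //= ltr_pdivrMr // mul1r ltrD2r.
  by split=> // -[|k] kn //; rewrite -h // /code iterSr.
rewrite big_ord_recl /= -e; case bE : (b 0%N).
  exists (rho + (1 - rho) * a), (rho + (1 - rho) * c).
  have hc : rho + (1 - rho) * c <= 1.
    by rewrite -lerBrDl ger_pMr.
  split=> //.
  - by rewrite addr_ge0 ?(ltW r0) // mulr_ge0 // ltW.
  - by rewrite lerD2l ler_pM2l.
  - by rewrite opprD addrACA subrr add0r mulrBr.
  apply/seteqP; split => x.
    move/step => [x01]; rewrite bE => hx; rewrite E /= /branch ltNge hx /= !in_itv /=.
    by rewrite ler_pdivlMr // ltr_pdivrMr // lerBrDl ltrBlDl ![_ * (1 - rho)]mulrC.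
  move=> hx; have {}hx : rho + (1 - rho) * a <= x < rho + (1 - rho) * c by [].
  have /andP[hxa hxc] := hx; have rx : rho <= x.
    by apply: le_trans hxa; rewrite lerDl mulr_ge0 // ltW.
  apply/step; rewrite bE rx; split=> //.
    by rewrite in_itv /= (le_trans (ltW r0) rx) (lt_le_trans hxc).
  rewrite E /= /branch ltNge rx /= in_itv /=.
  by rewrite ler_pdivlMr // ltr_pdivrMr // lerBrDl ltrBlDl ![_ * (1 - rho)]mulrC.
exists (rho * a), (rho * c).
have hc : rho * c <= rho by rewrite ger_pMr.
split=> //.
- by rewrite mulr_ge0 // ltW.
- by rewrite ler_pM2l.
- by rewrite (le_trans hc) // ltW.
- by rewrite mulrBr.
apply/seteqP; split => x.
  move/step => [x01]; rewrite bE => /negbT; rewrite -ltNge => hx.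
  rewrite E /= /branch hx !in_itv /=.
  by rewrite ler_pdivlMr // ltr_pdivrMr // ![_ * rho]mulrC.
move=> hx; have {}hx : rho * a <= x < rho * c by [].
have /andP[hxa hxc] := hx; have rx : x < rho by apply: lt_le_trans hc.
apply/step; rewrite bE [rho <= x]leNgt rx; split=> //.
  rewrite in_itv /= (lt_trans rx) // andbT; apply: le_trans hxa.
  by rewrite mulr_ge0 // ltW.
rewrite E /= /branch rx /= in_itv /=.
by rewrite ler_pdivlMr // ltr_pdivrMr // ![_ * rho]mulrC.
Qed.

Let leb01 := mrestr (@lebesgue_measure R) (measurable_itv `[(0:R), 1[).
HB.instance Definition _ := Measure.on leb01.
Let bern : set Omega -> \bar R := pushforward leb01 code.

Let bern0 : bern set0 = 0%E.
Proof. by rewrite /bern /pushforward preimage_set0 measure0. Qed.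

Let bern_ge0 A : (0 <= bern A)%E.
Proof. by rewrite /bern /pushforward measure_ge0. Qed.

Let bern_sigma : semi_sigma_additive bern.
Proof.
move=> F mF tF mUF; rewrite /bern /pushforward preimage_bigcup.
apply: measure_semi_sigma_additive.
- by move=> n; rewrite -[X in measurable X]setTI; exact: mcode.
- apply/trivIsetP => /= i j _ _ ij; rewrite -preimage_setI.
  by move/trivIsetP : tF => /(_ _ _ _ _ ij) -> //; rewrite preimage_set0.
- by rewrite -preimage_bigcup -[X in measurable X]setTI; exact: mcode.
Qed.

HB.instance Definition _ := isMeasure.Build _ _ _ bern bern0 bern_ge0 bern_sigma.

Let bern_cyl n (b : nat -> bool) : bern [set omega : Omega | forall k, (k < n)%N -> omega k = b k] =
  (\prod_(k < n) (if b k then 1 - rho else rho))%:E.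
Proof.
have [a [c [a0 ac c1 e E]]] := cylE n b.
rewrite /bern /pushforward /leb01 /mrestr -e.
rewrite (_ : _ `&` _ = [set` `[a, c[ ]).
  rewrite lebesgue_measure_itv /= lte_fin -EFinD; case: ltP => // ca.
  by rewrite (@le_anti _ _ a c) ?ac // subrr.
by rewrite -E; apply/seteqP; split => x /= [].
Qed.

Let bern1 : bern setT = 1%E.
Proof.
have := bern_cyl 0 (fun=> true); rewrite big_ord0 => <-.
by congr bern; apply/seteqP; split.
Qed.

HB.instance Definition _ := Measure_isProbability.Build _ _ _ bern bern1.

Lemma bernoulli_product_exists : exists mu, is_bernoulli_product rho mu.
Proof. by exists bern => n b; exact: bern_cyl. Qed.
End existence.

(* Main.v *)
Require Import Defs.
From HB Require Import structures.
From mathcomp Require Import all_boot all_order all_algebra.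
From mathcomp Require Import fingroup cyclic separable cyclotomic finfield qfpoly.
From mathcomp Require Import all_classical all_reals all_analysis.
From mathcomp Require Import finmap measurable_realfun complex.
From mathcomp Require Import ring lra zify.

(** The exceptional set E = {2} suffices, and no result on primitive roots is
    needed.  Split t^n - 1 = f s, where the irreducible factors of s are those
    inverted in R_omega.  Then R_omega is the direct sum of the polynomials of
    degree < deg f and of (t^n - 1) R_omega, so |F_n| = p^(deg f); in particular
    the growth rate is invariant under n -> p n, and every growth rate is itself
    a limit point.

    For p odd, t^(2^j) - 1 = (t - 1) prod_(i < j) (t^(2^i) + 1) with pairwise
    coprime factors.  If v is an irreducible factor of t^(2^i) + 1, then t has
    order 2^(i+1) in the residue field of v, whence deg v >= 2^(i+1) / p^2: the
    number of irreducible factors of t^(2^i) + 1 is at most p^2, uniformly in i.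
    Hence, almost surely, for every r and both values b there are infinitely many
    runs of r consecutive indices i such that omega = b at all the irreducible
    factors of t^(2^i) + 1.  At the end of such a run the growth rate at 2^j is
    at most 2^-r log p (b = 1), resp. at least (1 - 2^-r) log p (b = 0), and it
    is < log p as soon as some factor has been inverted. *)

Set Implicit Arguments.
Unset Strict Implicit.
Unset Printing Implicit Defensive.

Import Order.TTheory GRing.Theory Num.Theory.
Import numFieldNormedType.Exports.

Local Open Scope classical_set_scope.
Local Open Scope ring_scope.

(** * Polynomials over finite fields *)

Lemma irreducible_factor_exists (F : fieldType) (q : {poly F}) :
  (1 < size q)%N ->
  exists v, [/\ v \is monic, irreducible_poly v & v %| q].
Proof.
have [n] := ubnP (size q); elim: n q => // n IH q qn q1.
have q0 : q != 0 by rewrite -size_poly_gt0 ltnW.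
have lq0 : lead_coef q != 0 by rewrite lead_coef_eq0.
case: (pselect (irreducible_poly q)) => [irr|nirr].
  exists ((lead_coef q)^-1 *: q); split.
  - by rewrite monicE lead_coefZ mulVf.
  - split=> [|d d1]; first by rewrite size_scale ?invr_eq0.
    rewrite dvdpZr ?invr_eq0 // => /(irr.2 _ d1) e.
    by rewrite (eqp_trans e) // eqp_sym eqp_scale ?invr_eq0.
  - by rewrite dvdpZl ?invr_eq0.
have [d [d1 dq ndq]] : exists d : {poly F}, [/\ size d != 1%N, d %| q & ~~ (d %= q)].
  apply: contrapT => h; apply: nirr; split=> // d d1 dq.
  by apply/negPn/negP => e; apply: h; exists d.
have sd : (size d < size q)%N.
  by rewrite ltn_neqAle dvdp_leq // andbT; rewrite dvdp_size_eqp.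
have d0 : d != 0 by apply: contraNneq q0 => d0; rewrite d0 dvd0p in dq.
have [||v [vm vi vd]] := IH d; first exact: leq_trans sd _.
  by rewrite ltn_neqAle eq_sym d1 size_poly_gt0.
by exists v; split=> //; exact: dvdp_trans dq.
Qed.

Lemma coprimep_irreducible (F : fieldType) (a b : {poly F}) : a != 0 ->
  (forall v, v \is monic -> irreducible_poly v -> v %| a -> v %| b -> False) ->
  coprimep a b.
Proof.
move=> a0 h; rewrite coprimep_def; apply: contrapT => /negP g1.
have [|v [vm vi]] := @irreducible_factor_exists _ (gcdp a b).
  by rewrite ltn_neqAle eq_sym g1 size_poly_gt0 gcdp_eq0 (negbTE a0).
by rewrite dvdp_gcd => /andP[va vb]; exact: h va vb.
Qed.

Lemma monic_irreducible_dvd_eq (F : fieldType) (u v : {poly F}) :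
  u \is monic -> v \is monic -> irreducible_poly u -> irreducible_poly v ->
  u %| v -> u = v.
Proof.
move=> um vm [u1 _] [_ vi] uv; apply/eqP; rewrite -eqp_monic //.
by apply: vi => //; rewrite neq_ltn u1 orbT.
Qed.

Lemma irreducible_dvdM (F : fieldType) (v a b : {poly F}) :
  irreducible_poly v -> v %| a * b -> (v %| a) || (v %| b).
Proof.
move=> vi; case: (boolP (v %| a)) => //= va.
by rewrite Gauss_dvdpr // irreducible_poly_coprime.
Qed.

Lemma irreducible_dvdX (F : fieldType) (v a : {poly F}) n :
  irreducible_poly v -> v %| a ^+ n -> v %| a.
Proof.
move=> vi; elim: n => [|n IH].
  by rewrite expr0 dvdp1 => /eqP h; case: vi => vi _; rewrite h in vi.
by rewrite exprS => /(irreducible_dvdM vi)/orP[].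
Qed.

(** With [T] the set of inverted primes, [s] is the part of [q] that becomes a unit in the ring and
    [f] the part that survives there. *)
Definition split_at (F : fieldType) (T : set {poly F}) (q f s : {poly F}) :=
  [/\ q = f * s,
    forall v, v \is monic -> irreducible_poly v -> v %| s -> T v &
    forall v, v \is monic -> irreducible_poly v -> v %| f -> ~ T v].

(** Irreducible factors are peeled off one by one and assigned to [s] or [f] according to membership
    in [T]. *)
Lemma split_at_exists (F : fieldType) (T : set {poly F}) (q : {poly F}) :
  q != 0 -> exists f s, split_at T q f s.
Proof.
have [n] := ubnP (size q); elim: n q => // n IH q qn q0.
have [q1|q1] := leqP (size q) 1.
  have nodiv (v : {poly F}) : irreducible_poly v -> v %| q -> False.
    move=> [v1 _] /(dvdp_leq q0) vq.
    by have := leq_trans v1 (leq_trans vq q1).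
  exists 1, q; split; rewrite ?mul1r // => v vm vi vd; first by case: (nodiv v).
  by case: vi; rewrite dvdp1 in vd; rewrite (eqP vd).
have [v [vm vi /dvdpP[q' qE]]] := irreducible_factor_exists q1.
have v0 := irredp_neq0 vi.
have q'0 : q' != 0 by apply: contraNneq q0 => e; rewrite qE e mul0r.
have [v1 _] := vi.
have [|f [s [e hs hf]]] := IH q' _ q'0.
  move: qn; rewrite qE size_mul // ltnS; apply: leq_trans.
  by case: (size v) v1 => [|[|m]] // _; rewrite !addnS leq_addr.
case: (pselect (T v)) => Tv.
  exists f, (v * s); split=> //; first by rewrite qE e -mulrA [v * s]mulrC.
  move=> w wm wi /(irreducible_dvdM wi)/orP[wv|]; last exact: hs.
  by rewrite (monic_irreducible_dvd_eq wm vm wi vi wv).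
exists (v * f), s; split=> //; first by rewrite qE e mulrC mulrA.
move=> w wm wi /(irreducible_dvdM wi)/orP[wv|]; last exact: hf.
by rewrite (monic_irreducible_dvd_eq wm vm wi vi wv).
Qed.

Lemma split_atX (F : fieldType) (T : set {poly F}) (q f s : {poly F}) n :
  split_at T q f s -> split_at T (q ^+ n) (f ^+ n) (s ^+ n).
Proof.
move=> [-> hs hf]; split; first by rewrite exprMn.
  by move=> v vm vi /(irreducible_dvdX vi); exact: hs.
by move=> v vm vi /(irreducible_dvdX vi); exact: hf.
Qed.

(** All primes of [b] lie in [T] and none of those of [f] do, so [f] is coprime to [b]. This serves
    as an upper bound for the degree of [f]; its counterpart [split_at_dvd_r] serves as a lower
    bound. *)
Lemma split_at_dvd_l (F : fieldType) (T : set {poly F}) (q f s a b : {poly F}) :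
  q != 0 -> split_at T q f s -> q = a * b ->
  (forall v, v \is monic -> irreducible_poly v -> v %| b -> T v) -> f %| a.
Proof.
move=> q0 [qE hs hf] qab hb; have cfb : coprimep f b.
  apply: coprimep_irreducible => [|v vm vi va vb].
    by apply: contraNneq q0 => f0; rewrite qE f0 mul0r.
  exact: hf va (hb _ vm vi vb).
by rewrite -(Gauss_dvdpl a cfb) -qab qE dvdp_mulr.
Qed.

Lemma split_at_dvd_r (F : fieldType) (T : set {poly F}) (q f s a b : {poly F}) :
  q != 0 -> split_at T q f s -> q = a * b ->
  (forall v, v \is monic -> irreducible_poly v -> v %| b -> ~ T v) -> b %| f.
Proof.
move=> q0 [qE hs hf] qab hb; have cbs : coprimep b s.
  apply: coprimep_irreducible => [|v vm vi va vb].
    by apply: contraNneq q0 => b0; rewrite qab b0 mulr0.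
  exact: hb va (hs _ vm vi vb).
by rewrite -(Gauss_dvdpl f cbs) -qE qab dvdp_mull.
Qed.

(** * Powers of 2 in p^d - 1 and the irreducible factors of X^(2^i) + 1 *)

Lemma odd_sum_exp m d : odd m -> odd (\sum_(i < d) m ^ i) = odd d.
Proof.
move=> mo; elim: d => [|d IH]; first by rewrite big_ord0.
by rewrite big_ord_recr /= oddD IH oddX mo orbT addbT.
Qed.

(** The cofactor of m - 1 in m^d - 1 is a sum of d odd terms, hence odd, so the whole power of 2
    divides m - 1. *)
Lemma exp2_dvd_predX_odd m d J : odd m -> odd d -> (1 < m)%N ->
  (2 ^ J %| (m ^ d).-1)%N -> (2 ^ J <= m)%N.
Proof.
move=> mo od m1; rewrite predn_exp Gauss_dvdl; last first.
  by rewrite coprime_sym coprimeXr // coprimen2 odd_sum_exp.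
by move=> h; apply: leq_trans (leq_pred m); apply: dvdn_leq h; rewrite -subn1 subn_gt0.
Qed.

(* Writing d = 2 ^ a * c with c odd, the 2-adic valuation of p ^ d - 1 is at
   most that of p ^ 2 - 1 plus a. *)
Lemma exp2_dvd_predX_leq p d J : odd p -> (1 < p)%N -> (0 < d)%N ->
  (2 ^ J %| (p ^ d).-1)%N -> (2 ^ J <= p ^ 2 * d)%N.
Proof.
move=> po p1; have [n] := ubnP d; elim: n d J => // n IH d J dn d0 h.
have le2 x e : (0 < e)%N -> (x <= p ^ 2 -> x <= p ^ 2 * e)%N.
  by move=> e0 xp; apply: leq_trans xp _; rewrite leq_pmulr.
case: (boolP (odd d)) => [od|].
  apply: le2 => //; apply: leq_trans (exp2_dvd_predX_odd po od p1 h) _.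
  by rewrite -{1}(expn1 p) leq_exp2l.
move=> /even_halfK dE; move: h; rewrite -dE -muln2; set e := d./2.
have e0 : (0 < e)%N by rewrite half_gt0; case: (d) d0 dE => [|[|]].
(* For e odd, p^(2e) = (p^2)^e falls under the odd case with base p^2. *)
case: (boolP (odd e)) => [eo|].
  rewrite mulnC expnM => h; apply: le2; first by rewrite muln_gt0.
  by apply: exp2_dvd_predX_odd h; rewrite ?oddX ?po ?orbT // -(exp1n 2) ltn_exp2r.
move=> /even_halfK eE; set f := e./2 in eE.
case: J => [|J] h; first by rewrite expn0 muln_gt0 expn_gt0 muln_gt0 e0 ltnW.
rewrite expnS [(e * 2)%N]mulnC mulnCA leq_mul2l /=; apply: IH => //.
  by rewrite -ltnS; apply: leq_trans dn; rewrite ltnS -dE -addnn -{1}[e]addn0 ltn_add2l.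
(* For e even, p^e is the square of an odd number 2x + 1, so p^e + 1 = 2(2x(x+1) + 1) is twice an
   odd number. Doubling the exponent e therefore gains exactly one factor 2. *)
have [c cE] : exists c, (p ^ e).+1 = (2 * c.*2.+1)%N.
  exists ((p ^ f)./2 * (p ^ f)./2.+1)%N; rewrite -eE -muln2 expnM.
  have : odd (p ^ f) by rewrite oddX po orbT.
  move: (p ^ f)%N => y yo; rewrite -{1}(odd_double_half y) yo.
  by move: (y./2) => x; rewrite -!muln2 -mulnn; lia.
have : (2 ^ J.+1 %| 2 * ((p ^ e).-1 * c.*2.+1))%N.
  rewrite mulnCA -cE; have <- // : (p ^ (e * 2)).-1 = ((p ^ e).-1 * (p ^ e).+1)%N.
  rewrite expnM; have : (0 < p ^ e)%N by rewrite expn_gt0 ltnW.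
  by case: (p ^ e)%N => // x _; rewrite -!mulnn; lia.
rewrite expnS dvdn_pmul2l // Gauss_dvdl // coprimeXl // coprime2n /=.
by rewrite odd_double.
Qed.

(** The class x of X in the residue field of [v] satisfies x^(2^i) = -1, which differs from 1
    because 2 is nonzero. Its order thus divides 2^(i+1) but not 2^i, so it equals 2^(i+1), and
    Lagrange applies in the unit group. *)
Lemma exp2_dvd_card_residue_field (F : finFieldType) (v : {poly F}) i :
  (2%:R : F) != 0 -> v \is monic -> irreducible_poly v -> v %| 'X^(2 ^ i) + 1 ->
  (2 ^ i.+1 %| (#|F| ^ (size v).-1).-1)%N.
Proof.
move=> F2 vm vi vd.
pose mi : monic_irreducible_poly v := (vi, vm).
rewrite -(card_qfpoly mi).
pose L : finFieldType := {poly %/ v with mi}.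
rewrite -[X in X.-1]/#|L|.
have [x xE] : exists x : L, x ^+ (2 ^ i) = -1.
  exists (in_qpoly v 'X); apply/eqP; rewrite -subr_eq0 opprK.
  have <- : in_qpoly v ('X^(2 ^ i) + 1) = 0.
    apply/val_eqP => /=; rewrite /mk_monic ifT; last by rewrite vm andbT vi.1.
    by rewrite -Pdiv.IdomainMonic.modpE //; apply/eqP.
  by rewrite rmorphD rmorphXn rmorph1.
have L2 : (-1 : L) != 1.
  rewrite eq_sym -subr_eq0 opprK -[1 + 1]/(2%:R).
  by rewrite -(rmorph_nat (qpolyC v)) (fmorph_eq0 (qpolyC v : {rmorphism F -> L})).
have Ux : x \in GRing.unit.
  rewrite unitfE; apply/eqP => x0; move/eqP: xE.
  by rewrite x0 expr0n expn_eq0 /= eq_sym oppr_eq0 oner_eq0.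
pose u : {unit L} := FinRing.unit _ Ux.
have uE k : (u ^+ k == 1)%g = (x ^+ k == 1) by rewrite -val_eqE /= FinRing.val_unitX.
have u1 : (u ^+ (2 ^ i) != 1)%g by rewrite uE xE.
have u2 : (u ^+ (2 ^ i.+1) == 1)%g by rewrite uE expnSr exprM xE sqrrN expr1n.
rewrite -(card_finField_unit L).
have := u2; rewrite -order_dvdn => /(dvdn_pfactor _ _ (isT : prime 2))[k ki uk].
have : (#[u]%g %| #|[set: {unit L}]%SET|)%N by apply: order_dvdG; rewrite inE.
rewrite uk; suff -> : k = i.+1 by [].
apply/eqP; rewrite eqn_leq ki ltnNge; apply: contra u1 => ki'.
by rewrite -order_dvdn uk dvdn_exp2l.
Qed.

Lemma prod_monic_irreducible_dvd (F : fieldType) (s : seq {poly F}) q :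
  uniq s ->
  (forall v, v \in s -> [/\ v \is monic, irreducible_poly v & v %| q]) ->
  \prod_(v <- s) v %| q.
Proof.
elim: s => [|v s IH]; first by rewrite big_nil dvd1p.
move=> /= /andP[vs us] h; rewrite big_cons.
have [vm vi vq] := h v (mem_head _ _).
have hs u : u \in s -> [/\ u \is monic, irreducible_poly u & u %| q].
  by move=> us'; apply: h; rewrite inE us' orbT.
rewrite Gauss_dvdp ?vq ?IH // big_seq.
apply: (big_ind (coprimep v)) => [|a b ha hb|u us'].
- exact: coprimep1.
- by rewrite coprimepMr ha.
have [um ui _] := hs _ us'; rewrite irreducible_poly_coprime //.
apply: contra vs => vu.
by rewrite (monic_irreducible_dvd_eq vm um vi ui vu).
Qed.

Lemma size_prod_monic (F : fieldType) (s : seq {poly F}) :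
  (forall v, v \in s -> v \is monic) ->
  (size (\prod_(v <- s) v)).-1 = (\sum_(v <- s) (size v).-1)%N.
Proof.
elim: s => [|v s IH] h; first by rewrite !big_nil size_poly1.
have vm := h v (mem_head _ _).
have hs u : u \in s -> u \is monic by move=> us; apply: h; rewrite inE us orbT.
have sm : \prod_(u <- s) u \is monic by rewrite big_seq; exact: monic_prod.
have v0 := monic_neq0 vm; have s0 := monic_neq0 sm; rewrite !big_cons -IH //.
rewrite size_Mmonic //; move: v0 s0; rewrite -!size_poly_gt0.
by case: (size v) => // m; case: (size _) => // k _ _; rewrite /= addnS.
Qed.

(** The degrees of distinct irreducible factors add up to at most 2^i, while each of them is at
    least 2^(i+1) / |F|^2. The bound does not involve i. *)
Lemma size_irreducible_factors_Xexp2D1 (F : finFieldType) i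
    (s : seq {poly F}) : (2%:R : F) != 0 -> odd #|F| -> uniq s ->
  (forall v, v \in s ->
     [/\ v \is monic, irreducible_poly v & v %| 'X^(2 ^ i) + 1]) ->
  (size s <= #|F| ^ 2)%N.
Proof.
move=> F2 oF us h; have F1 := finNzRing_gt1 F.
have i0 : (0 < 2 ^ i)%N by rewrite expn_gt0.
have h1 : (\sum_(v <- s) (size v).-1 <= 2 ^ i)%N.
  rewrite -size_prod_monic; last by move=> v /h[].
  rewrite -ltnS prednK ?size_poly_gt0; last first.
    by apply/monic_neq0; rewrite big_seq; apply: monic_prod => v /h[].
  rewrite -(size_XnaddC (1 : F) i0) dvdp_leq ?prod_monic_irreducible_dvd //.
  by rewrite -size_poly_gt0 size_XnaddC.
have h2 : (size s * 2 ^ i.+1 <= #|F| ^ 2 * \sum_(v <- s) (size v).-1)%N.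
  rewrite big_distrr -sum1_size big_distrl /= !big_seq leq_sum // => v /h[vm vi vd].
  rewrite mul1n exp2_dvd_predX_leq // ?exp2_dvd_card_residue_field //.
  by case: vi => vi _; rewrite -subn1 subn_gt0.
rewrite -(leq_pmul2r i0); apply: leq_trans (leq_trans h2 _).
  by rewrite leq_mul2l leq_exp2l ?leqnSn ?orbT.
by rewrite leq_mul2l h1 orbT.
Qed.

(** Iterated difference of squares. The first factor carries only the share 2^-r of the total
    degree. *)
Lemma Xexp2_factor (F : fieldType) m r :
  'X^(2 ^ (m + r)) - 1 =
  ('X^(2 ^ m) - 1) * \prod_(i < r) ('X^(2 ^ (m + i)) + 1) :> {poly F}.
Proof.
elim: r => [|r IH]; first by rewrite addn0 big_ord0 mulr1.
rewrite big_ord_recr /= mulrA -IH addnS expnSr exprM.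
by rewrite -[X in _ - X](expr1n _ 2) subr_sqr.
Qed.

(** For i < j, X^(2^i) + 1 divides X^(2^j) - 1, so a common factor with X^(2^j) + 1 divides the
    nonzero constant 2. This makes the sets of coordinates attached to different i disjoint, hence
    independent. *)
Lemma Xexp2D1_coprime (F : fieldType) (v : {poly F}) i j :
  (2%:R : F) != 0 -> irreducible_poly v ->
  v %| 'X^(2 ^ i) + 1 -> v %| 'X^(2 ^ j) + 1 -> i = j.
Proof.
move=> F2 vi; wlog ij : i j / (i <= j)%N.
  move=> h hi hj; have [ij|/ltnW ij] := leqP i j; first exact: h.
  by apply/esym/h.
move=> hi hj; apply/eqP; rewrite eqn_leq ij leqNgt; apply/negP => {}ij.
have hi' : v %| 'X^(2 ^ j) - 1.
  rewrite -(subnKC ij) Xexp2_factor dvdp_mulr // -[i.+1]addn1 (Xexp2_factor _ i 1).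
  by rewrite big_ord1 addn0 dvdp_mull.
have : v %| (2%:R : F)%:P.
  rewrite polyC_natr (_ : 2%:R = ('X^(2 ^ j) + 1) - ('X^(2 ^ j) - 1)).
    by rewrite dvdp_sub.
  by rewrite opprD opprK addrACA subrr add0r.
move=> /dvdp_leq; rewrite polyC_eq0 F2 size_polyC F2 => /(_ isT).
by case: vi => v1 _; rewrite leqNgt v1.
Qed.

(** * The Bernoulli product measure *)

Section bernoulli_product.
Context (R : realType) (rho : R) (hrho : 0 < rho < 1).
Context (mu : probability Omega R) (hmu : is_bernoulli_product rho mu).

Definition bernoulli_weight (b : bool) : R := if b then 1 - rho else rho.
Local Notation w := bernoulli_weight.

Lemma bernoulli_weight_gt0 b : 0 < w b.
Proof. by have /andP[r0 r1] := hrho; case: b; rewrite //= subr_gt0. Qed.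

Lemma bernoulli_weight_lt1 b : w b < 1.
Proof. by have /andP[r0 r1] := hrho; case: b; rewrite //= gtrBl. Qed.

Lemma measurable_coordinate k b :
  measurable [set omega : Omega | omega k = b].
Proof. by apply: sub_sigma_algebra; exists k, b. Qed.

Lemma measurable_all_in (K : seq nat) (b : nat -> bool) :
  measurable [set omega : Omega | forall k, k \in K -> omega k = b k].
Proof.
elim: K => [|a K IH].
  rewrite (_ : mkset _ = setT); first exact: measurableT.
  by apply/seteqP; split.
rewrite (_ : mkset _ = [set omega : Omega | omega a = b a] `&`
    [set omega : Omega | forall k, k \in K -> omega k = b k]).
  by apply: measurableI => //; exact: measurable_coordinate.
apply/seteqP; split=> omega /= => [h|[h1 h2] k].
  by split=> [|k kK]; apply: h; rewrite inE ?eqxx // kK orbT.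
by rewrite inE => /predU1P[->|/h2].
Qed.

(** The hypothesis on [mu] only concerns events fixing all coordinates below n. Those outside [J]
    are released one at a time: the case i = 0 is the hypothesis, and for i = n only the coordinates
    in [J] remain fixed. *)
Lemma bernoulli_cylinder (J : pred nat) n i b :
  mu [set omega : Omega | forall k, (k < n)%N -> (i <= k)%N || J k ->
        omega k = b k] =
  (\prod_(k < n | (i <= k)%N || J k) w (b k))%:E.
Proof.
elim: i b => [|i IH] b.
  rewrite (_ : mkset _ =
    [set omega : Omega | forall k, (k < n)%N -> omega k = b k]) ?hmu //.
  by apply/seteqP; split=> omega /= h k kn; [exact: h|move=> _; exact: h].
have sameJ (P Q : pred nat) : (forall k, (k < n)%N -> P k = Q k) ->
    mu [set omega : Omega | forall k, (k < n)%N -> P k -> omega k = b k] =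
      (\prod_(k < n | P k) w (b k))%:E ->
    mu [set omega : Omega | forall k, (k < n)%N -> Q k -> omega k = b k] =
      (\prod_(k < n | Q k) w (b k))%:E.
  move=> PQ; rewrite (eq_bigl (fun k : 'I_n => Q k)) => [<-|k]; last exact: PQ.
  by congr (mu _); apply/seteqP; split=> omega /= h k kn hk; apply: h => //;
    rewrite ?PQ // -PQ.
have [ni|ni] := leqP n i.
  apply: sameJ (IH b) => k kn; congr (_ || _).
  have ki := leq_trans kn ni; rewrite [LHS]leqNgt [RHS]leqNgt ltnS ki.
  by rewrite (ltnW ki).
have [iJ|iJ] := boolP (J i).
  apply: sameJ (IH b) => k kn; rewrite [LHS]orbC [RHS]orbC.
  by case: (eqVneq i k) => [<-|ik]; rewrite ?iJ // (leq_eqVlt i) (negbTE ik).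
(* When i is outside [J], the event with coordinate i released is the disjoint union of the two
   events prescribing the value x = true or x = false at i. *)
pose b' x k := if k == i then x else b k.
pose A x := [set omega : Omega | forall k, (k < n)%N -> (i <= k)%N || J k ->
  omega k = b' x k].
have mA x : measurable (A x).
  rewrite (_ : A x = [set omega : Omega | forall k,
    k \in [seq k <- iota 0 n | (i <= k)%N || J k] -> omega k = b' x k]).
    exact: measurable_all_in.
  apply/seteqP; split=> omega /= h k.
    by rewrite mem_filter mem_iota => /andP[hk kn]; apply: h.
  by move=> kn hk; apply: h; rewrite mem_filter hk mem_iota.
rewrite (_ : mkset _ = A true `|` A false); last first.
  apply/seteqP; split=> omega /=.
    move=> h; have hx x : omega i = x -> A x omega.
      move=> ix k kn hk; rewrite /b'; case: eqVneq => [->//|ki]; apply: h => //.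
      by rewrite ltn_neqAle eq_sym ki.
    by case E : (omega i); [left|right]; apply: hx.
  have hx x : A x omega -> forall k, (k < n)%N -> (i < k)%N || J k -> omega k = b k.
    move=> h k kn hk; have ki : k != i.
      by apply: contraTneq hk => ->; rewrite ltnn.
    by rewrite h /b' ?(negbTE ki) //; case/orP: hk => [/ltnW|] ->; rewrite ?orbT.
  by case=> h; exact: hx h.
have prodE x : mu (A x) = (w x * \prod_(k < n | (i < k)%N || J k) w (b k))%:E.
  rewrite IH (bigD1 (Ordinal ni)) /=; last by rewrite leqnn.
  rewrite /b' eqxx; congr (_ * _)%:E; apply: eq_big => [k|k].
    rewrite -val_eqE /=; case: (eqVneq (k : nat) i) => [->|ki] /=.
      by rewrite ltnn (negbTE iJ) andbF.
    by rewrite andbT (leq_eqVlt i k) (eq_sym i k) (negbTE ki).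
  by move=> /andP[_]; rewrite -val_eqE /= => /negbTE ->.
(* The two weights of coordinate i add up to 1. *)
transitivity (mu (A true) + mu (A false))%E; last first.
  by rewrite !prodE -EFinD -mulrDl /= subrK mul1r.
apply: measureU => //; apply/seteqP; split=> omega //= -[h1 h2].
have := h1 i ni; rewrite h2 // /b' ?eqxx leqnn // => /(_ isT).
by [].
Qed.

Definition constant_on (s : seq nat) b : set Omega :=
  [set omega | forall k, k \in s -> omega k = b].

Definition no_constant_block (K : nat -> seq nat) b M : set Omega :=
  [set omega | forall m, (m < M)%N -> ~ constant_on (K m) b omega].

Lemma measurable_constant_on s b : measurable (constant_on s b).
Proof. exact: (measurable_all_in s (fun=> b)). Qed.

Lemma measurable_no_constant_block K b M :
  measurable (no_constant_block K b M).
Proof.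
rewrite (_ : no_constant_block K b M =
  \bigcap_(m in [set m | (m < M)%N]) ~` constant_on (K m) b) //.
by apply: bigcap_measurableType => m _; apply: measurableC;
  exact: measurable_constant_on.
Qed.

Lemma bernoulli_constant_on (s : seq nat) b : uniq s ->
  mu (constant_on s b) = (w b ^+ size s)%:E.
Proof.
move=> us; pose n := (\max_(k <- s) k).+1.
have sn k : k \in s -> (k < n)%N by move=> ks; rewrite ltnS leq_bigmax_seq.
(* [n] exceeds every element of [s]; taking i = n leaves exactly the coordinates in [s]
   constrained. *)
have := bernoulli_cylinder (fun k => k \in s) n n (fun=> b).
rewrite (_ : mkset _ = constant_on s b).
  move=> ->; congr _%:E.
  rewrite (eq_bigl (fun k : 'I_n => (k : nat) \in s)) => [|k]; last first.
    by rewrite leqNgt ltn_ord.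
  rewrite -(big_mkord (fun k => k \in s) (fun=> w b)) -big_filter.
  rewrite (perm_big s) ?big_const_seq ?count_predT ?iter_mulr_1 //.
  apply: uniq_perm => //; first by rewrite filter_uniq ?iota_uniq.
  move=> k; rewrite mem_filter mem_iota add0n subn0 andbC.
  by case: (boolP (k \in s)) => [/sn ->|]; rewrite ?andbF.
apply/seteqP; split=> omega /= h k; last first.
  by move=> kn; rewrite leqNgt kn /=; exact: h.
by move=> ks; apply: h; [exact: sn|rewrite ks orbT].
Qed.

(* Generalizing over s makes the induction on M close: the last block is
   excluded by subtracting the same event for s enlarged by that block. *)
Lemma bernoulli_no_constant_block (K : nat -> seq nat) b M (s : seq nat) :
  (forall m, uniq (K m)) -> uniq s ->
  (forall m m' k, k \in K m -> k \in K m' -> m = m') ->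
  (forall m k, (m < M)%N -> k \in K m -> k \notin s) ->
  mu (constant_on s b `&` no_constant_block K b M) =
  (w b ^+ size s * \prod_(m < M) (1 - w b ^+ size (K m)))%:E.
Proof.
move=> uK us dK; elim: M s us => [|M IH] s us ds.
  rewrite big_ord0 mulr1 -bernoulli_constant_on //; congr (mu _).
  by apply/seteqP; split=> omega /=; [case|split].
pose A t N := constant_on t b `&` no_constant_block K b N.
have mA t N : measurable (A t N).
  apply: measurableI; first exact: measurable_constant_on.
  exact: measurable_no_constant_block.
have ds' m k : (m < M)%N -> k \in K m -> k \notin s ++ K M.
  move=> mM km; rewrite mem_cat negb_or (ds m) //; last exact: ltnW.
  by apply: contraTN mM => kM; rewrite (dK _ _ _ km kM) ltnn.
rewrite -/(A s M.+1) (_ : A s M.+1 = A s M `\` A (s ++ K M) M); last first.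
  apply/seteqP; split=> omega /=.
    move=> [h1 h2]; split; first by split=> // m mM; apply: h2; exact: ltnW.
    by move=> [h3 _]; apply: (h2 M) => // k kM; apply: h3; rewrite mem_cat kM orbT.
  move=> [[h1 h2] h3]; split=> // m; rewrite ltnS leq_eqVlt.
  move=> /predU1P[->|]; last exact: h2.
  by move=> hM; apply: h3; split=> // k; rewrite mem_cat => /orP[/h1//|/hM//].
have -> : mu (A s M `\` A (s ++ K M) M) =
    (mu (A s M) - mu (A s M `&` A (s ++ K M) M))%E.
  by apply: measureD; rewrite ?ltey_eq ?fin_num_measure.
rewrite setIidr; last first.
  move=> omega [h1 h2]; split=> // k ks; apply: h1; by rewrite mem_cat ks.
rewrite /A IH //; last by move=> m k mM; apply: ds; exact: ltnW.
rewrite IH //; last first.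
  rewrite cat_uniq us uK andbT; apply/hasPn => k kM; exact: (ds M).
rewrite -EFinB size_cat exprD big_ord_recr /=; congr _%:E.
by ring.
Qed.

(** Disjoint blocks are independent and each is constantly b with probability at least w(b)^C, so
    the first M blocks all fail with probability at most (1 - w(b)^C)^M, which tends to 0. *)
Lemma ae_constant_block (K : nat -> seq nat) b C :
  (forall m, uniq (K m)) -> (forall m, size (K m) <= C)%N ->
  (forall m m' k, k \in K m -> k \in K m' -> m = m') ->
  {ae mu, forall omega : Omega, exists m, constant_on (K m) b omega}.
Proof.
move=> uK sK dK; pose A := no_constant_block K b.
have mA M : measurable (A M) by exact: measurable_no_constant_block.
have c0 := bernoulli_weight_gt0 b; have c1 := bernoulli_weight_lt1 b.
have muA M : (mu (A M) <= ((1 - w b ^+ C) ^+ M)%:E)%E.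
  have := bernoulli_no_constant_block b (M := M) (s := [::])
    uK isT dK (fun _ _ _ _ => isT).
  rewrite expr0 mul1r (_ : _ `&` _ = A M); last first.
    by apply/seteqP; split=> omega => [[]//|h]; split.
  move=> ->; rewrite lee_fin -[M in X in _ <= X]card_ord -prodr_const.
  apply: ler_prod => m _; apply/andP; split.
    by rewrite subr_ge0 exprn_ile1 ?ltW.
  by rewrite lerD2l lerN2 ler_wiXn2l // ltW.
have mN : measurable (\bigcap_M A M) by exact: bigcap_measurableType.
exists (\bigcap_M A M); split=> //.
- apply/eqP; rewrite eq_le measure_ge0 andbT.
  have q1 : `|1 - w b ^+ C| < 1.
    rewrite ger0_norm ?subr_ge0 ?exprn_ile1 ?ltW //.
    by rewrite gtrBl exprn_gt0.
  rewrite -(fineK (fin_num_measure mu _ mN)) lee_fin.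
  have <- := cvg_lim (@Rhausdorff R) (cvg_expr q1).
  apply: limr_ge; first exact: cvgP (cvg_expr q1).
  apply: nearW => M; rewrite -lee_fin fineK ?fin_num_measure //.
  apply: le_trans (muA M); apply: le_measure; try exact/mem_set.
  by move=> omega /(_ M I).
- move=> omega /= h M _ m mM hm; apply: h; by exists m.
Qed.

(** The windows of r consecutive indices starting at N + m r, for varying m, are disjoint. The union
    of the [K i] over one window is a block of at most C r coordinates, and only countably many
    triples (r, N, b) occur. *)
Lemma ae_constant_runs (K : nat -> seq nat) C :
  (forall i, uniq (K i)) -> (forall i, size (K i) <= C)%N ->
  (forall i j k, k \in K i -> k \in K j -> i = j) ->
  {ae mu, forall omega : Omega, forall (r N : nat) b,
    exists m, (N <= m)%N /\
      forall i, (m <= i < m + r)%N -> constant_on (K i) b omega}.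
Proof.
move=> uK sK dK; apply: ae_foralln => r; apply: ae_foralln => N.
have block b : {ae mu, forall omega : Omega, exists m, (N <= m)%N /\
    forall i, (m <= i < m + r)%N -> constant_on (K i) b omega}.
  pose B m := undup (flatten [seq K i | i <- iota (N + m * r) r]).
  have BP m k : reflect (exists2 i, (N + m * r <= i < N + m * r + r)%N & k \in K i)
      (k \in B m).
    rewrite mem_undup; apply: (iffP flatten_mapP) => -[j].
      by rewrite mem_iota; exists j.
    by exists j; rewrite // mem_iota.
  apply: filterS (@ae_constant_block B b (C * r) _ _ _).
  - move=> omega [m hm]; exists (N + m * r)%N; split; first exact: leq_addr.
    by move=> i hi k ki; apply: hm; apply/BP; exists i.
  - by move=> m; exact: undup_uniq.
  - move=> m; apply: leq_trans (size_undup _) _; rewrite size_flatten sumnE.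
    rewrite /shape -map_comp big_map.
    apply: (@leq_trans (\sum_(i <- iota (N + m * r) r) C)%N).
      by apply: leq_sum => i _; exact: sK.
    by rewrite big_const_seq count_predT size_iota iter_addn_0.
  - move=> m m' k /BP[i hi ki] /BP[j hj kj].
    rewrite -(dK _ _ _ ki kj) in hj.
    case: (ltngtP m m') => // mm'; have := leq_mul mm' (leqnn r); rewrite mulSn;
      by move: hi hj; lia.
apply: filterS2 (block true) (block false) => omega h1 h0 b.
by case: b.
Qed.
End bernoulli_product.

(** * Characters of finite exponent *)

(** In characteristic 0, X^n - 1 is separable, so it has n distinct roots, and these contain a
    primitive one. *)
Lemma closed_prim_root_exists (C : numClosedFieldType) n :
  (0 < n)%N -> exists z : C, n.-primitive_root z.
Proof.
move=> n0; have [r Dp] := closed_field_poly_normal ('X^n - 1 : {poly C}).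
rewrite (monicP _) ?monicXnsubC // scale1r in Dp.
have rn1 : all n.-unity_root r by apply/allP => z; rewrite -root_prod_XsubC -Dp.
have sz_r : (n < (size r).+1)%N.
  by rewrite -(size_prod_XsubC r id) -Dp size_XnsubC.
have [|z] := hasP (has_prim_root n0 rn1 _ sz_r); last by exists z.
by rewrite -separable_prod_XsubC -Dp separable_Xn_sub_1 // pnatr_eq0 -lt0n.
Qed.

Lemma dual_ext (R : realType) (G : zmodType) (chi psi : dual R G) :
  chi =1 psi -> chi = psi.
Proof.
case: chi psi => [f fn fa] [g gn ga] /= fg; have e : f = g by apply/funext.
by subst g; rewrite (Prop_irrelevance fn gn) (Prop_irrelevance fa ga).
Qed.

Section character.
Context (R : realType) (G : zmodType) (chi : dual R G).

Lemma char0 : chi 0 = 1.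
Proof.
have chi0 : chi 0 != 0 by rewrite -normr_eq0 char_norm oner_eq0.
by apply: (mulfI chi0); rewrite -char_add addr0 mulr1.
Qed.

Lemma charMn x n : chi (x *+ n) = chi x ^+ n.
Proof.
elim: n => [|n IH]; first by rewrite char0.
by rewrite mulrS char_add IH exprS.
Qed.

Lemma char_sum (I : Type) (r : seq I) (F : I -> G) :
  chi (\sum_(i <- r) F i) = \prod_(i <- r) chi (F i).
Proof. exact: (big_morph _ (char_add chi) char0). Qed.

Lemma char_eq x y : chi (x - y) = 1 -> chi x = chi y.
Proof. by rewrite -{2}(subrK y x) char_add => ->; rewrite mul1r. Qed.
End character.

Section card_annihilator.
Context (R : realType) (G : zmodType) (p : nat) (p_prime : prime p) (D : nat).
Context (rho : {additive G -> 'rV['F_p]_D}) (sigma : 'rV['F_p]_D -> G).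
Context (sigmaK : cancel sigma rho).
Context (zeta : R[i]) (zeta_prim : p.-primitive_root zeta).

Let expFp (z : 'F_p) : R[i] := zeta ^+ z.

Let expFpD z1 z2 : expFp (z1 + z2) = expFp z1 * expFp z2.
Proof.
by rewrite /expFp -exprD /= [X in (_ %% X)%N]Fp_cast // (prim_expr_mod zeta_prim).
Qed.

Let expFp_inj : injective expFp.
Proof.
move=> z1 z2 /eqP; rewrite (eq_prim_root_expr zeta_prim).
have zp (z : 'F_p) : (z < p)%N by rewrite -{2}(Fp_cast p_prime).
by rewrite !modn_small // => /eqP /val_inj.
Qed.

Let expFp_norm z : `|expFp z| = 1.
Proof.
rewrite normrX (_ : `|zeta| = 1) ?expr1n //; apply/eqP.
rewrite -(@pexpr_eq1 _ _ p) ?prime_gt0 //.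
by rewrite -normrX (prim_expr_order zeta_prim) normr1.
Qed.

Let pairing (c : 'rV['F_p]_D) (x : G) : 'F_p := \sum_i c 0 i * rho x 0 i.

Let pairingD c x y : pairing c (x + y) = pairing c x + pairing c y.
Proof.
by rewrite -big_split; apply: eq_bigr => i _; rewrite raddfD mxE mulrDr.
Qed.

Let pairing_char (c : 'rV['F_p]_D) : dual R G.
Proof.
apply: (@Character R G (expFp \o pairing c)) => [x|x y] /=.
  exact: expFp_norm.
by rewrite pairingD expFpD.
Defined.

Let pairing_sigma c i : pairing c (sigma (delta_mx 0 i)) = c 0 i.
Proof.
rewrite /pairing sigmaK (bigD1 i) //= big1 => [|j ji].
  by rewrite addr0 mxE !eqxx mulr1.
by rewrite mxE (negbTE ji) andbF mulr0.
Qed.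

Let pairing_char_inj : injective pairing_char.
Proof.
move=> c c' cc'; apply/rowP => i.
have := congr1 (fun chi : dual R G => chi (sigma (delta_mx 0 i))) cc'.
by rewrite /= !pairing_sigma => /expFp_inj.
Qed.

(** These are the characters of G / ker rho, a copy of F_p^D. Such a character is determined by its
    values on lifts of the basis vectors; those values are p-th roots of unity, and their exponents
    with respect to [zeta] form the vector c of [pairing_char c]. *)
Let annihilator : set (dual R G) := [set chi | forall x, rho x = 0 -> chi x = 1].

Let annihilatorE : annihilator = pairing_char @` setT.
Proof.
apply/seteqP; split=> chi /=; last first.
  move=> [c _ <-] x x0 /=; rewrite /pairing x0 big1 ?/expFp ?expr0 // => i _.
  by rewrite mxE mulr0.
move=> hchi; have chiE x y : rho x = rho y -> chi x = chi y.
  by move=> xy; apply/char_eq/hchi; rewrite raddfB xy subrr.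
pose e i := sigma (delta_mx 0 i).
have rhoMn x n i : rho (x *+ n) 0 i = n%:R * rho x 0 i.
  by rewrite raddfMn mulmxnE mulr_natl.
have chi_root i : chi (e i) ^+ p = 1.
  rewrite -charMn; apply: hchi; apply/rowP => j.
  by rewrite rhoMn pchar_Fp_0 // mul0r mxE.
have chi_exp i : exists k : 'I_p, chi (e i) = zeta ^+ k.
  by have [k kE] := prim_rootP zeta_prim (chi_root i); exists k.
have [k kE] := choice chi_exp.
exists (\row_i (k i : nat)%:R) => //; apply: dual_ext => x /=.
(* Both arguments have the same image under [rho]. *)
have -> : chi x = chi (\sum_i e i *+ (rho x 0 i : nat)).
  apply: chiE; rewrite raddf_sum; apply/rowP => j.
  rewrite summxE (bigD1 j) //= big1 => [|i ij]; last first.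
    by rewrite rhoMn sigmaK mxE eq_sym (negbTE ij) andbF mulr0.
  by rewrite rhoMn sigmaK mxE !eqxx mulr1 addr0 natr_Zp.
rewrite char_sum (big_morph _ expFpD (id1 := 1)); last by rewrite /expFp expr0.
apply: eq_bigr => i _; rewrite charMn kE -exprM mxE /expFp.
by rewrite -{1}(natr_Zp (rho x 0 i)) -natrM val_Fp_nat // prim_expr_mod.
Qed.

Lemma card_annihilator_root :
  #|` fset_set annihilator|%fset = (p ^ D)%N.
Proof.
rewrite annihilatorE (_ : image _ _ =
  [set` [fset pairing_char c | c in 'rV['F_p]_D]%fset]).
  rewrite set_fsetK card_imfset //=.
  by rewrite -cardE card_mx mul1n card_Fp.
apply/seteqP; split=> chi /=.
  by move=> [c _ <-]; apply/imfsetP; exists c.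
by move=> /imfsetP[c _ ->]; exists c.
Qed.
End card_annihilator.

Lemma card_annihilator (R : realType) (G : zmodType) (p D : nat)
    (rho : {additive G -> 'rV['F_p]_D}) (sigma : 'rV['F_p]_D -> G) :
  prime p -> cancel sigma rho ->
  #|` fset_set [set chi : dual R G | forall x, rho x = 0 -> chi x = 1]|%fset =
  (p ^ D)%N.
Proof.
move=> p_prime sigmaK.
have [zeta zeta_prim] := closed_prim_root_exists R[i] (prime_gt0 p_prime).
exact: card_annihilator_root zeta_prim.
Qed.

(** * Counting periodic points *)

Lemma subrACA (V : zmodType) (x y z t : V) : (x - y) - (z - t) = (x - z) - (y - t).
Proof. by rewrite !opprD !opprK addrACA. Qed.

Definition place_poly (p : nat) (w : place p) : {poly 'F_p} :=
  if w is FinitePlace u _ _ then u else 0.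

Section periodic.
Context (R : realType) (p : nat) (p_prime : prime p) (v : place_enum p).

Lemma place_poly_inj (w w' : place p) :
  w <> InfinitePlace -> w' <> InfinitePlace -> place_poly w = place_poly w' ->
  w = w'.
Proof.
case: w w' => [|u um ui] [|u' um' ui'] //= _ _ e; subst u'.
by rewrite (Prop_irrelevance um um') (Prop_irrelevance ui ui').
Qed.

(** The shift matches [R_pred]: [omega k] governs the place of index k + 1, which skips infinity and
    t. *)
Definition prime_at (k : nat) : {poly 'F_p} := place_poly (v k.+1%:Z).

Lemma prime_at_monic k : prime_at k \is monic.
Proof. by rewrite /prime_at; have [w [wm [wi ->]]] := place_enum_finite v k. Qed.

Lemma prime_at_irreducible k : irreducible_poly (prime_at k).
Proof. by rewrite /prime_at; have [w [wm [wi ->]]] := place_enum_finite v k. Qed.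

Lemma prime_at_inj : injective prime_at.
Proof.
move=> k j kj; have fin i : v i.+1%:Z <> InfinitePlace.
  by have [w [wm [wi ->]]] := place_enum_finite v i.
have [_ inj _] := place_at_bij v.
have dom i : i.+1%:Z \in [set i : int | -1 <= i] by apply/mem_set.
have := inj _ _ (dom k) (dom j) (place_poly_inj (fin k) (fin j) kj).
by case.
Qed.

Lemma prime_at_surj u : u \is monic -> irreducible_poly u -> u != 'X ->
  exists k, u = prime_at k.
Proof.
move=> um ui uX; have [_ _ surj] := place_at_bij v.
have [j /= j1 jE] := surj (FinitePlace um ui) I.
case: j j1 jE => [[|k]|[|k]] //= _ jE.
- have [Xm [Xi e]] := place_at_t v; rewrite e in jE.
  by case: jE uX => <-; rewrite eqxx.
- by exists k; rewrite /prime_at jE.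
- by have := place_at_infty v; rewrite jE.
Qed.

Variable omega : nat -> bool.

(** In lowest terms, a prime dividing the denominator does not divide the numerator and gives x a
    pole; integrality at a place with [omega k = false] thus keeps its prime out of the
    denominator. *)
Lemma R_pred_fraction (x : ratfun p) : x \in R_pred v omega ->
  exists a b, [/\ b != 0, x * tofrac b = tofrac a &
    forall k, omega k = false -> ~~ (prime_at k %| b)].
Proof.
have p1 := prime_gt1 p_prime; have [->|x0] := eqVneq x 0.
  move=> _; exists 0, 1; rewrite oner_eq0 mul0r tofrac0; split=> // k _.
  rewrite dvdp1 neq_ltn orbC.
  by have [-> _] := prime_at_irreducible k.
move=> /asboolP hx.
have := ratfun_repr x; have := denom_ratioP (generic_quotient.repr x).
move: (frac (generic_quotient.repr x)).1 (frac (generic_quotient.repr x)).2.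
move=> a b b0 xE.
have a0 : a != 0 by rewrite -tofrac_eq0 -xE mulf_neq0 ?tofrac_eq0.
pose g := gcdp a b; have g0 : g != 0 by rewrite gcdp_eq0 (negbTE a0).
have aE : a = a %/ g * g by rewrite divpK ?dvdp_gcdl.
have bE : b = b %/ g * g by rewrite divpK ?dvdp_gcdr.
have xE' : x * tofrac (b %/ g) = tofrac (a %/ g).
  apply: (mulIf (x := tofrac g)); first by rewrite tofrac_eq0.
  by rewrite -mulrA -!tofracM -aE -bE.
have a'0 : a %/ g != 0 by apply: contraNneq a0 => e; rewrite aE e mul0r.
have b'0 : b %/ g != 0 by apply: contraNneq b0 => e; rewrite bE e mul0r.
have cop : coprimep (a %/ g) (b %/ g) by rewrite coprimep_div_gcd // a0.
exists (a %/ g), (b %/ g); split=> // k /hx; rewrite place_abs_le1 //.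
rewrite (place_ordE _ b'0 x0 xE') subr_ge0 /prime_at.
have [u [um [ui ->]]] := place_enum_finite v k; rewrite /= lez_nat => h.
apply/negP => ub; have u1 := ui.1.
have ua : u %| a %/ g.
  rewrite -(expr1 u) (poly_multP 1 u1 a'0); apply: leq_trans h.
  by rewrite -(poly_multP 1 u1 b'0) expr1.
have /coprimepP/(_ u ua ub) := cop.
by rewrite -size_poly_eq1 => /eqP u_1; rewrite u_1 in u1.
Qed.

Lemma fraction_R_pred (x : ratfun p) a b : b != 0 -> x * tofrac b = tofrac a ->
  (forall k, omega k = false -> ~~ (prime_at k %| b)) ->
  x \in R_pred v omega.
Proof.
move=> b0 xE hb; apply/asboolP => k /hb.
rewrite /prime_at; have [u [um [ui ->]]] := place_enum_finite v k => /= ub.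
apply/place_abs_le1P; first exact: prime_gt1.
exists a, b; split=> //; apply/orP; right; rewrite /= lez_nat.
suff -> : poly_mult u b = 0%N by [].
by apply/eqP; rewrite -leqn0 leqNgt -(poly_multP 1 ui.1 b0) expr1.
Qed.

(** The unit t is absent from this set; as t does not divide t^n - 1 for n > 0, the splitting of t^n
    - 1 is the same. *)
Definition inverted : set {poly 'F_p} :=
  [set u | exists2 k, omega k = true & u = prime_at k].

Section split.
Context (n : nat) (n_gt0 : (0 < n)%N) (f s : {poly 'F_p}).
Context (fs : split_at inverted ('X^n - 1) f s).

Let q0 : 'X^n - 1 != 0 :> {poly 'F_p}.
Proof. by apply/monic_neq0/monicXnsubC. Qed.

Let fsE : 'X^n - 1 = f * s. Proof. by case: fs. Qed.
Let f0 : f != 0. Proof. by apply: contraNneq q0 => e; rewrite fsE e mul0r. Qed.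
Let s0 : s != 0. Proof. by apply: contraNneq q0 => e; rewrite fsE e mulr0. Qed.

(** A common prime of [f] and [b] is not t, so it is some [prime_at k]; dividing [f] forces
    [omega k = false], which [b] excludes. *)
Lemma coprime_noninverted b : b != 0 ->
  (forall k, omega k = false -> ~~ (prime_at k %| b)) -> coprimep f b.
Proof.
move=> b0 hb; apply: coprimep_irreducible => // u um ui uf ub.
have uX : u != 'X.
  apply: contraTneq uf => ->; apply/negP => Xf.
  have : root ('X^n - 1 : {poly 'F_p}) 0.
    by rewrite -dvdp_XsubCl polyC0 subr0 fsE dvdp_mulr.
  by rewrite rootE !hornerE expr0n eqn0Ngt n_gt0 sub0r oppr_eq0 oner_eq0.
have [k kE] := prime_at_surj um ui uX; have [_ _ /(_ u um ui uf) uT] := fs.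
have : ~~ (prime_at k %| b).
  by apply: hb; apply/negP => ok; apply: uT; exists k.
by rewrite -kE ub.
Qed.

Lemma prime_at_ndvd_inverted k : omega k = false -> ~~ (prime_at k %| s).
Proof.
move=> ok; apply/negP => ks; have [_ /(_ _ _ _ ks) hT _] := fs.
have [j oj /prime_at_inj e] := hT (prime_at_monic k) (prime_at_irreducible k).
by rewrite e oj in ok.
Qed.

(** Write x = a / b. By Bezout, u1 f + u2 b = 1, so u2 inverts b modulo f and x is congruent to u2 a
    modulo f. Since [s] is a unit of the ring, [f] and t^n - 1 generate the same ideal. *)
Lemma residue_exists (x : R_ring v omega) :
  exists r : {poly 'F_p}, (size r < size f)%N /\ exists y : R_ring v omega,
    R_val x - tofrac r = tofrac ('X^n - 1) * R_val y.
Proof.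
have [a [b [b0 xE hb]]] := R_pred_fraction (R_valP x).
have /Bezout_eq1_coprimepP[[u1 u2] /= e] := coprime_noninverted b0 hb.
exists ((u2 * a) %% f); split; first by rewrite ltn_modp.
pose q := (u2 * a) %/ f; have qE : u2 * a = q * f + (u2 * a) %% f.
  exact: divp_eq.
have bs0 : b * s != 0 by rewrite mulf_neq0.
have tb0 : tofrac b != 0 by rewrite tofrac_eq0.
have ts0 : tofrac s != 0 by rewrite tofrac_eq0.
have tbs0 : tofrac (b * s) != 0 by rewrite tofrac_eq0.
(* With r = u2 a - q f, the Bezout relation gives x - r = f (a u1 + q b) / b; the extra [s] below
   turns f into t^n - 1. *)
have y_in : tofrac (a * u1 + q * b) / tofrac (b * s) \in R_pred v omega.
  apply: (fraction_R_pred (a := a * u1 + q * b) bs0).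
    exact: divfK tbs0 _.
  move=> k ok; apply/negP => /(irreducible_dvdM (prime_at_irreducible k))/orP[].
    by apply/negP/hb.
  by apply/negP/prime_at_ndvd_inverted.
exists (RRing y_in) => /=.
apply: (mulIf tb0); rewrite mulrBl xE fsE.
have eF (F : fieldType) (x1 x2 x3 x4 : F) : x2 != 0 -> x3 != 0 ->
    (x1 * x2) * (x4 / (x3 * x2)) * x3 = x1 * x4.
  by move=> h2 h3; field; rewrite h2 h3.
rewrite (tofracM f s) (tofracM b s) (eF _ _ _ _ _ ts0 tb0).
rewrite -(tofracM f) -(tofracM ((u2 * a) %% f)) -tofracB; congr tofrac.
have eA (A : comNzRingType) (x1 x2 x3 x4 x5 x6 : A) :
  x1 * (x2 * x4 + x3 * x5) - (x3 * x1 - x6 * x4) * x5 =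
  x4 * (x1 * x2 + x6 * x5) by ring.
have -> : (u2 * a) %% f = u2 * a - q * f.
  by apply/eqP; rewrite eq_sym subr_eq addrC; apply/eqP.
by rewrite -(eA _ a u1 u2 f b q) e mulr1.
Qed.

(** Clearing the denominator b of y gives r b = f s a. As [f] is coprime to b, it divides r, which
    is too small unless zero. *)
Lemma residue_unique (r : {poly 'F_p}) (y : R_ring v omega) :
  (size r < size f)%N -> tofrac r = tofrac ('X^n - 1) * R_val y -> r = 0.
Proof.
move=> rf rE; have [a [b [b0 yE hb]]] := R_pred_fraction (R_valP y).
have : f %| r * b.
  have -> : r * b = f * (s * a).
    apply/eqP; rewrite -tofrac_eq mulrA -fsE [X in X == _]tofracM rE.
    by rewrite tofracM -yE mulrA.
  exact: dvdp_mulr.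
rewrite Gauss_dvdpl ?coprime_noninverted // => fr.
by apply/eqP; apply: contraTT rf => r0; rewrite -leqNgt dvdp_leq.
Qed.

Lemma poly_R_pred (r : {poly 'F_p}) : tofrac r \in R_pred v omega.
Proof.
apply: (fraction_R_pred (a := r) (b := 1)); rewrite ?oner_eq0 ?mulr1 //.
move=> k _; rewrite dvdp1 neq_ltn orbC.
by have [-> _] := prime_at_irreducible k.
Qed.

Local Notation D := (size f).-1.

Let size_lt (r : {poly 'F_p}) : (size r <= D)%N = (size r < size f)%N.
Proof. by rewrite -ltnS prednK // size_poly_gt0. Qed.

(** The projection along the ideal of t^n - 1: existence of residues allows a pointwise choice of
    [rho], and their uniqueness makes it additive. *)
Lemma residue_map : {rho : {additive R_ring v omega -> 'rV['F_p]_D} |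
  (forall c, rho (RRing (poly_R_pred (rVpoly c))) = c) /\
  forall x, rho x = 0 <-> exists y, x = (R_t v omega ^+ n - 1) * y}.
Proof.
pose ideal (z : ratfun p) := exists y : R_ring v omega,
  z = tofrac ('X^n - 1) * R_val y.
have idealB z z' : ideal z -> ideal z' -> ideal (z - z').
  by move=> [y ->] [y' ->]; exists (y - y'); rewrite /= mulrBr.
have /choice[rho rhoP] (x : R_ring v omega) :
    exists c : 'rV['F_p]_D, ideal (R_val x - tofrac (rVpoly c)).
  have [r [rf [y e]]] := residue_exists x; exists (poly_rV r).
  by rewrite poly_rV_K ?size_lt //; exists y.
have uniq x c : ideal (R_val x - tofrac (rVpoly c)) -> rho x = c.
  move=> hc; have [y yE] := idealB _ _ hc (rhoP x).
  apply: (can_inj rVpolyK); apply/eqP; rewrite -subr_eq0; apply/eqP.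
  apply: (@residue_unique _ y).
    rewrite -size_lt -linearB; exact: size_poly.
  by rewrite -yE tofracB subrACA subrr sub0r opprB.
have rhoB : zmod_morphism rho.
  move=> x y; apply: uniq; rewrite linearB tofracB /= subrACA.
  exact: idealB.
pose rhoM := GRing.isZmodMorphism.Build _ _ rho rhoB.
pose rhoA : {additive R_ring v omega -> 'rV['F_p]_D} := HB.pack rho rhoM.
exists rhoA; split=> [c|x] /=.
  by apply: uniq; rewrite /= subrr; exists 0; rewrite mulr0.
have tE (y : R_ring v omega) : R_val ((R_t v omega ^+ n - 1) * y) =
    tofrac ('X^n - 1) * R_val y.
  rewrite /= ; congr (_ * _); rewrite tofracB tofrac1 tofracXn; congr (_ - _).
  by elim: (n) => //= m IH; rewrite exprS /= IH exprS.
split=> [x0|[y ->]].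
  have := rhoP x; rewrite x0 linear0 tofrac0 subr0 => -[y yE]; exists y.
  by apply: val_inj; rewrite [RHS]tE.
by apply: uniq; rewrite linear0 tofrac0 subr0; exists y; rewrite tE.
Qed.

Lemma iter_alphaE m (chi : X_dual R v omega) x :
  iter m (@alpha R p v omega) chi x = chi (R_t v omega ^+ m * x).
Proof.
elim: m x => [|m IH] x; first by rewrite mul1r.
by rewrite iterS /= IH mulrA -exprSr.
Qed.

(** A character is fixed by the n-th iterate exactly when it is trivial on the multiples of t^n - 1,
    that is, on the kernel of [rho]. *)
Lemma card_periodic_points :
  #|` fset_set (@periodic_points R p v omega n)|%fset = (p ^ D)%N.
Proof.
have [rho [sigmaK rho0]] := residue_map.
rewrite -(card_annihilator R p_prime sigmaK); congr (#|` fset_set _|%fset).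
apply/seteqP; split=> chi /= h.
  move=> x /rho0[y ->]; have := congr1 (fun psi : X_dual R v omega => psi y) h.
  rewrite iter_alphaE => e.
  rewrite mulrBl mul1r; have := char_add chi (R_t v omega ^+ n * y - y) y.
  rewrite subrK e => e2; apply: (mulIf (x := chi y)).
    by rewrite -normr_eq0 char_norm oner_eq0.
  by rewrite -e2 mul1r.
apply: dual_ext => x; rewrite iter_alphaE; apply: char_eq; apply: h.
by apply/rho0; exists x; rewrite mulrBl mul1r.
Qed.

End split.
End periodic.

(** * Growth rates *)

(** Otherwise every duplicate-free list of elements of [P] could be extended, eventually beyond
    length C. *)
Lemma bounded_pred_seq (P : pred nat) C :
  (forall s, uniq s -> all P s -> (size s <= C)%N) ->
  exists s, [/\ uniq s, s =i P & (size s <= C)%N].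
Proof.
move=> hC; apply: contrapT => no.
suff /(_ C.+1) [s [us Ps sC]] : forall m, exists s, [/\ uniq s, all P s & size s = m].
  by have := hC s us Ps; rewrite sC ltnn.
elim=> [|m [s [us Ps sm]]]; first by exists [::].
have [k [Pk ks]] : exists k, P k /\ k \notin s.
  apply: contrapT => h; apply: no; exists s; split=> //; last exact: hC.
  move=> k; apply/idP/idP => [/(allP Ps)//|Pk].
  by apply: contrapT => /negP ks; apply: h; exists k.
by exists (k :: s); rewrite /= ks us Pk Ps sm.
Qed.

Lemma irreducible_dvd_prod (F : fieldType) (u : {poly F}) r (q : nat -> {poly F}) :
  irreducible_poly u -> u %| \prod_(i < r) q i ->
  exists2 i, (i < r)%N & u %| q i.
Proof.
move=> ui; elim: r => [|r IH].
  by rewrite big_ord0 dvdp1 => /eqP u1; have := ui.1; rewrite u1.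
rewrite big_ord_recr => /(irreducible_dvdM ui)/orP[/IH[i ir uq]|uq].
  by exists i; rewrite // ltnW.
by exists r.
Qed.

Lemma limit_pointsP (R : realType) (u : nat -> R) l :
  (forall e N, 0 < e -> exists2 n, (N <= n)%N & `|l - u n| < e) ->
  limit_points u l.
Proof.
move=> h; have /choice[g gP] (kN : nat * nat) : exists n, (kN.2 <= n)%N /\
    `|l - u n| < kN.1.+1%:R^-1.
  have e0 : 0 < kN.1.+1%:R^-1 :> R by rewrite invr_gt0 ltr0Sn.
  by have [n Nn un] := h _ kN.2 e0; exists n.
pose phi := fix phi k := if k is j.+1 then g (k, (phi j).+1) else g (0, 0)%N.
exists phi; split.
  by apply: homo_ltn => [? ? ?|k]; [exact: ltn_trans|have [] := gP (k.+1, (phi k).+1)].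
have phiP k : `|l - u (phi k)| < k.+1%:R^-1.
  by case: k => [|k]; [have [] := gP (0, 0)%N|have [] := gP (k.+1, (phi k).+1)].
apply/cvgrPdist_lt => e e0; near=> k.
apply: (lt_trans (phiP k)).
by near: k; exact: near_infty_natSinv_lt (PosNum e0).
Unshelve. all: by end_near. Qed.

Lemma limit_points_itv (R : realType) (u : nat -> R) a b :
  (forall n, a <= u n <= b) -> limit_points u `<=` `[a, b].
Proof.
move=> uab l [phi [_ ul]]; rewrite /= in_itv /= -(cvg_lim (@Rhausdorff R) ul).
apply/andP; split; [apply: limr_ge|apply: limr_le]; try exact: cvgP ul;
  by apply: nearW => k; have /andP[] := uab (phi k).
Qed.

(** Each term is chosen below c, but above both its predecessor and c - 1/(k+1): the values increase
    strictly and tend to c. *)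
Lemma injective_sequence_below (R : realType) (u : nat -> R) (c : R) :
  (forall x, x < c -> exists j, x < u j < c) ->
  exists a : nat -> nat, injective (u \o a) /\ u \o a @ \oo --> c.
Proof.
move=> h; have /choice[g gP] (x : R) : exists j, x < c -> x < u j < c.
  case: (pselect (x < c)) => [/h[j]|xc]; first by exists j.
  by exists 0%N.
pose b k := c - k.+1%:R^-1.
have bc k : b k < c by rewrite /b gtrBl invr_gt0 ltr0Sn.
pose a := fix a k := if k is j.+1 then g (Num.max (u (a j)) (b k)) else g (b 0%N).
have mc k : u (a k) < c -> Num.max (u (a k)) (b k.+1) < c.
  by rewrite gt_max => ->; exact: bc.
have ac k : u (a k) < c.
  elim: k => [|k /mc/gP/andP[//]]; by have /andP[] := gP _ (bc 0%N).
have aS k : Num.max (u (a k)) (b k.+1) < u (a k.+1).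
  by have /andP[] := gP _ (mc k (ac k)).
have ab k : b k < u (a k).
  case: k => [|k]; first by have /andP[] := gP _ (bc 0%N).
  by have := aS k; rewrite gt_max => /andP[].
exists a; split.
  have incr : {homo u \o a : i j / (i < j)%N >-> i < j}.
    apply: homo_ltn => [? ? ?|k]; first exact: lt_trans.
    by have := aS k; rewrite gt_max => /andP[].
  move=> i j; case: (ltngtP i j) => // /incr + e; by rewrite e ltxx.
apply/cvgrPdist_lt => e e0; near=> k.
apply: (@lt_trans _ _ k.+1%:R^-1).
  by rewrite gtr0_norm ?subr_gt0 //= ltrBlDr -ltrBlDl; exact: ab.
by near: k; exact: near_infty_natSinv_lt (PosNum e0).
Unshelve. all: by end_near. Qed.

Lemma injective_infinite_set (T : Type) (A : set T) (a : nat -> T) :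
  injective a -> (forall k, A (a k)) -> infinite_set A.
Proof.
move=> ainj aA finA; apply: infinite_nat.
rewrite (_ : [set: nat] = a @^-1` A); last first.
  by apply/seteqP; split=> k _ //; exact: aA.
by apply: finite_preimage finA => i j _ _; exact: ainj.
Qed.

Section growth.
Context (R : realType) (p : nat) (p_prime : prime p) (v : place_enum p).
Context (omega : nat -> bool).
Local Notation growth := (growth_rate R v omega).
Local Notation inv := (inverted v omega).

Let lnp_gt0 : 0 < ln p%:R :> R.
Proof. by rewrite ln_gt0 // ltr1n prime_gt1. Qed.

Let Xn1_neq0 n : (0 < n)%N -> 'X^n - 1 != 0 :> {poly 'F_p}.
Proof. by move=> n0; apply/monic_neq0/monicXnsubC. Qed.

Lemma growth_rate_split n f s : (0 < n)%N -> split_at inv ('X^n - 1) f s ->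
  growth n = ln p%:R * ((size f).-1%:R / n%:R).
Proof.
move=> n0 fs; rewrite /growth_rate (card_periodic_points R p_prime n0 fs).
by rewrite natrX lnXn ?ltr0n ?prime_gt0 // -[ln _ *+ _]mulr_natr -mulrA.
Qed.

Lemma growth_rate_bounds n : (0 < n)%N -> 0 <= growth n <= ln p%:R.
Proof.
move=> n0; have [f [s fs]] := split_at_exists inv (Xn1_neq0 n0).
rewrite (growth_rate_split n0 fs); apply/andP; split.
  by rewrite mulr_ge0 ?divr_ge0 // ltW.
rewrite ger_pMr // ler_pdivrMr ?ltr0n // mul1r ler_nat.
have [e _ _] := fs; rewrite -ltnS prednK.
  rewrite -(size_XnsubC (1 : 'F_p) n0) dvdp_leq ?Xn1_neq0 //.
  by rewrite e dvdp_mulr.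
rewrite size_poly_gt0; apply: contraNneq (Xn1_neq0 n0) => f0.
by rewrite e f0 mul0r.
Qed.

(** X^(p^a n) - 1 is the p^a-th power of X^n - 1, so [f] is replaced by its p^a-th power and the
    ratio deg f / n is unchanged. *)
Lemma growth_rate_frobenius n a : (0 < n)%N -> growth (p ^ a * n) = growth n.
Proof.
move=> n0; have [f [s fs]] := split_at_exists inv (Xn1_neq0 n0).
have pa0 : (0 < p ^ a)%N by rewrite expn_gt0 prime_gt0.
have := split_atX (p ^ a) fs.
have -> : ('X^n - 1) ^+ (p ^ a) = 'X^(p ^ a * n) - 1 :> {poly 'F_p}.
  have pchar_pow : [pchar {poly 'F_p}].-nat (p ^ a)%N.
    rewrite (eq_pnat _ (pchar_poly 'F_p)) (eq_pnat _ (pcharf_eq (pchar_Fp p_prime))).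
    by rewrite pnatX pnat_id.
  rewrite exprDn_pchar // exprNn_pchar // expr1n -exprM mulnC //.
move=> fs'; rewrite (growth_rate_split _ fs') ?muln_gt0 ?pa0 //.
rewrite (growth_rate_split n0 fs) size_exp mulnC natrM natrM; congr (_ * _).
by rewrite invfM mulrACA divff ?mul1r // pnatr_eq0 -lt0n.
Qed.

Lemma growth_rate_limit_point n : (0 < n)%N ->
  growth_limit_points R v omega (growth n).
Proof.
move=> n0; apply: limit_pointsP => e N e0.
have p1 := prime_gt1 p_prime.
have Np : (N < p ^ N * n)%N.
  by apply: leq_trans (ltn_expl N p1) _; rewrite leq_pmulr.
(* The predecessor appears because limit points are taken along the rates of index n + 1. *)
exists (p ^ N * n).-1; first by rewrite -ltnS (ltn_predK Np).
by rewrite (ltn_predK Np) growth_rate_frobenius // subrr normr0.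
Qed.

Lemma growth_rate_le n a b : (0 < n)%N -> 'X^n - 1 = a * b :> {poly 'F_p} ->
  (forall u, u \is monic -> irreducible_poly u -> u %| b -> inv u) ->
  growth n <= ln p%:R * ((size a).-1%:R / n%:R).
Proof.
move=> n0 ab hb; have q0 := Xn1_neq0 n0.
have [f [s fs]] := split_at_exists inv q0.
rewrite (growth_rate_split n0 fs) ler_pM2l // ler_pM2r ?invr_gt0 ?ltr0n // ler_nat.
have a0 : a != 0 by apply: contraNneq q0 => a0; rewrite ab a0 mul0r.
by rewrite -!subn1 leq_sub2r // dvdp_leq // (split_at_dvd_l q0 fs ab).
Qed.

Lemma growth_rate_ge n a b : (0 < n)%N -> 'X^n - 1 = a * b :> {poly 'F_p} ->
  (forall u, u \is monic -> irreducible_poly u -> u %| b -> ~ inv u) ->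
  ln p%:R * ((size b).-1%:R / n%:R) <= growth n.
Proof.
move=> n0 ab hb; have q0 := Xn1_neq0 n0.
have [f [s fs]] := split_at_exists inv q0.
rewrite (growth_rate_split n0 fs) ler_pM2l // ler_pM2r ?invr_gt0 ?ltr0n // ler_nat.
have f0 : f != 0 by case: fs => e _ _; apply: contraNneq q0 => f0; rewrite e f0 mul0r.
by rewrite -!subn1 leq_sub2r // dvdp_leq // (split_at_dvd_r q0 fs ab).
Qed.

(** * Growth rates at powers of 2 *)

Context (K : nat -> seq nat).
Context (KP : forall i k, (k \in K i) = (prime_at v k %| 'X^(2 ^ i) + 1)).
Context (runs : forall (r N : nat) b, exists m, (N <= m)%N /\
  forall i, (m <= i < m + r)%N -> constant_on (K i) b omega).

Let exp2_gt0 j : (0 < 2 ^ j)%N. Proof. by rewrite expn_gt0. Qed.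

Lemma factor_Xexp2D1 u i : u \is monic -> irreducible_poly u ->
  u %| 'X^(2 ^ i) + 1 -> exists2 k, k \in K i & u = prime_at v k.
Proof.
move=> um ui ud; have uX : u != 'X.
  apply: contraTneq ud => ->; apply/negP => Xd.
  have : root ('X^(2 ^ i) + 1 : {poly 'F_p}) 0.
    by rewrite -dvdp_XsubCl polyC0 subr0.
  by rewrite rootE !hornerE expr0n eqn0Ngt exp2_gt0 add0r oner_eq0.
by have [k kE] := prime_at_surj v um ui uX; exists k; rewrite // KP -kE.
Qed.

Lemma run_inverted m r b u :
  (forall i, (m <= i < m + r)%N -> constant_on (K i) b omega) ->
  u \is monic -> irreducible_poly u ->
  u %| \prod_(i < r) ('X^(2 ^ (m + i)) + 1) -> if b then inv u else ~ inv u.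
Proof.
move=> hb um ui /(irreducible_dvd_prod (q := fun i => 'X^(2 ^ (m + i)) + 1) ui)[i ir].
move=> /(factor_Xexp2D1 um ui)[k kK kE].
have ok : omega k = b by apply: hb kK; rewrite leq_addr ltn_add2l.
case: b ok {hb} => ok; first by exists k.
by move=> [j oj]; rewrite kE => /prime_at_inj kj; rewrite kj oj in ok.
Qed.

Let exp2_div m r : (2 ^ m)%:R / (2 ^ (m + r))%:R = (2 ^ r)%:R^-1 :> R.
Proof.
rewrite expnD natrM; have := exp2_gt0 m; have := exp2_gt0 r.
by rewrite -!(ltr0n R) => /lt0r_neq0 h1 /lt0r_neq0 h2; field; rewrite h1 h2.
Qed.

Lemma growth_rate_low r N : exists2 j, (N <= j)%N &
  growth (2 ^ j) <= ln p%:R * (2 ^ r)%:R^-1.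
Proof.
have [m [Nm hm]] := runs r N true.
exists (m + r)%N; first exact: leq_trans (leq_addr _ _).
have ab := Xexp2_factor 'F_p m r.
apply: le_trans (growth_rate_le (exp2_gt0 _) ab (fun u => run_inverted hm)) _.
by rewrite size_XnsubC //= exp2_div.
Qed.

Lemma growth_rate_high r N : exists2 j, (N <= j)%N &
  ln p%:R * (1 - (2 ^ r)%:R^-1) <= growth (2 ^ j).
Proof.
have [m [Nm hm]] := runs r N false.
exists (m + r)%N; first exact: leq_trans (leq_addr _ _).
have ab := Xexp2_factor 'F_p m r.
apply: le_trans (growth_rate_ge (exp2_gt0 _) ab (fun u => run_inverted hm)).
have := congr1 (fun q : {poly _} => size q) ab.
move: (\prod_(i < r) _) ab => b ab.
have q0 := Xn1_neq0 (exp2_gt0 (m + r)).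
have b0 : b != 0 by apply: contraNneq q0 => b0; rewrite ab b0 mulr0.
rewrite size_mul ?Xn1_neq0 // !size_XnsubC //= => sb.
(* The run contributes degree 2^(m+r) - 2^m, all of which survives in [f]. *)
have -> : (size b).-1 = (2 ^ (m + r) - 2 ^ m)%N.
  by move: sb; move: (size b) (2 ^ m)%N (2 ^ (m + r))%N => x y z; lia.
rewrite ler_pM2l // natrB ?leq_exp2l ?leq_addr // mulrBl exp2_div.
by rewrite divff // pnatr_eq0 -lt0n.
Qed.

(** A run of length 1 inverts all primes of X^(2^m) + 1 for one m. This polynomial divides X^(2^j) -
    1 for every j > m, which costs [f] at least 2^m in degree. *)
Lemma growth_rate_strict : exists J, forall j, (J <= j)%N -> growth (2 ^ j) < ln p%:R.
Proof.
have [m [_ hm]] := runs 1 0 true; exists m.+1 => j mj.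
have [a ab] : exists a, 'X^(2 ^ j) - 1 =
    a * \prod_(i < 1) ('X^(2 ^ (m + i)) + 1) :> {poly 'F_p}.
  rewrite -(subnKC mj) Xexp2_factor -[m.+1]addn1 Xexp2_factor mulrAC.
  by eexists.
apply: le_lt_trans (growth_rate_le (exp2_gt0 _) ab (fun u => run_inverted hm)) _.
have q0 := Xn1_neq0 (exp2_gt0 j).
have a0 : a != 0 by apply: contraNneq q0 => a0; rewrite ab a0 mul0r.
have := congr1 (fun q : {poly _} => size q) ab.
rewrite big_ord1 addn0 size_mul // ?size_XnaddC // ?size_XnsubC //; last first.
  by rewrite -size_poly_gt0 size_XnaddC.
move=> sa; rewrite -[X in _ < X]mulr1 ltr_pM2l // ltr_pdivrMr ?ltr0n // mul1r ltr_nat.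
have := exp2_gt0 j; have := exp2_gt0 m; move: sa.
by move: (size a) (2 ^ m)%N (2 ^ j)%N => x y z; lia.
Qed.

Lemma growth_limit_points_runs :
  let L := growth_limit_points R v omega in
  [/\ L `<=` `[0, ln p%:R]%classic, infinite_set L, L 0, L (ln p%:R) &
      exists a : nat -> R,
        [/\ injective a, forall k, L (a k) & a @ \oo --> ln p%:R]].
Proof.
move=> L.
have small (e : R) : 0 < e -> exists r, ln p%:R * (2 ^ r)%:R^-1 < e.
  move=> e0; have rE := archi_boundP (ltW (divr_gt0 lnp_gt0 e0)).
  exists (Num.bound (ln p%:R / e)); rewrite ltr_pdivrMr ?ltr0n // mulrC -ltr_pdivrMr //.
  apply: lt_trans rE _; rewrite ltr_nat; exact: ltn_expl.
(* The rates at 2^j come arbitrarily close to log p along runs of zeros, yet stay strictly below it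
   from some J on; so infinitely many distinct values accumulate there, each itself a limit
   point. *)
have [a [ainj acvg]] : exists a : nat -> nat,
    injective ((fun j => growth (2 ^ j)) \o a) /\
    (fun j => growth (2 ^ j)) \o a @ \oo --> (ln p%:R : R).
  apply: injective_sequence_below => x xc.
  have /small[r hr] : 0 < ln p%:R - x by rewrite subr_gt0.
  have [J hJ] := growth_rate_strict; have [j Jj hj] := growth_rate_high r J.
  exists j; rewrite hJ // andbT; apply: lt_le_trans hj; rewrite mulrBr mulr1; lra.
have aL k : L (growth (2 ^ a k)) by exact: growth_rate_limit_point.
split.
- by apply: limit_points_itv => n; exact: growth_rate_bounds.
- exact: injective_infinite_set ainj aL.
- apply: limit_pointsP => e N /small[r hr].
  have [j Nj hj] := growth_rate_low r N.+1.
  have j2 := ltn_expl j (isT : 1 < 2)%N.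
  exists (2 ^ j).-1; first by lia.
  have /andP[g0 _] := growth_rate_bounds (exp2_gt0 j).
  rewrite prednK // sub0r normrN ger0_norm //; exact: le_lt_trans hr.
- apply: limit_pointsP => e N /small[r hr].
  have [j Nj hj] := growth_rate_high r N.+1.
  have j2 := ltn_expl j (isT : 1 < 2)%N.
  exists (2 ^ j).-1; first by lia.
  have /andP[_ g1] := growth_rate_bounds (exp2_gt0 j).
  rewrite prednK // ger0_norm ?subr_ge0 //; apply: le_lt_trans hr.
  by move: hj; rewrite mulrBr mulr1; lra.
- by exists ((fun j => growth (2 ^ j)) \o a).
Qed.
End growth.

Theorem theorem6 (R : realType)
    (v : forall p : nat, prime p -> place_enum p)
    (rho : R) (hrho : 0 < rho < 1)
    (mu : probability Omega R) (hmu : is_bernoulli_product rho mu) :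
  exists E : seq nat, [/\ (size E <= 2)%N, all prime E &
    forall (p : nat) (hp : prime p), p \notin E ->
      {ae mu, forall omega : Omega,
        let L := growth_limit_points R (v p hp) omega in
        [/\ L `<=` `[0, ln p%:R]%classic,
            infinite_set L,
            L 0,
            L (ln p%:R) &
            exists a : nat -> R,
              [/\ injective a, forall k, L (a k) & a @ \oo --> ln p%:R]]}].
Proof.
(* For p = 2, X^(2^i) + 1 = (X + 1)^(2^i), and the factors are no longer coprime. *)
exists [:: 2]; split=> // p hp; rewrite inE => p2.
have op : odd p by have [e|//] := even_prime hp; rewrite e eqxx in p2.
have F2 : (2%:R : 'F_p) != 0.
  by rewrite -(dvdn_pcharf (pchar_Fp hp)) dvdn_prime2.
(* The lists [K i] depend on p and on the enumeration of places but not on [omega], so they are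
   fixed blocks of coordinates, of size at most p^2. *)
have hK i : exists s : seq nat, [/\ uniq s,
    s =i [pred k | prime_at (v p hp) k %| 'X^(2 ^ i) + 1] & (size s <= p ^ 2)%N].
  apply: bounded_pred_seq => s us hs.
  rewrite -(size_map (prime_at (v p hp))).
  have := @size_irreducible_factors_Xexp2D1 'F_p i _ F2; rewrite card_Fp //; apply=> //.
  - by rewrite map_inj_uniq //; exact: prime_at_inj.
  - move=> _ /mapP[k ks ->]; split; [exact: prime_at_monic|exact: prime_at_irreducible|].
    exact: (allP hs).
have [K KP] := choice hK.
have Kdisj i j k : k \in K i -> k \in K j -> i = j.
  have [[_ -> _] [_ -> _]] := (KP i, KP j).
  exact: Xexp2D1_coprime F2 (prime_at_irreducible _ _).
apply: filterS (ae_constant_runs hrho hmu (C := (p ^ 2)%N) _ _ Kdisj).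
- move=> omega runs; apply: (@growth_limit_points_runs R p hp (v p hp) omega K) => // i k.
  by have [_ ->] := KP i.
- by move=> i; have [] := KP i.
- by move=> i; have [] := KP i.
Qed.
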